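(* Let a compact topological group $G$ act on a stratifiable space $Y$, and let $X$ be a closed $G$-invariant subspace of $Y$ with $|X|\ge 2$. Then there exists a positive linear extension operator $T:C_{inv}(X\times X)\to C_{inv}(Y\times Y)$, continuous in the compact-open topology, that preserves constant functions, bounded invariant functions, invariant pseudometrics, and invariant metrics. If the space $Y$ is metrizable, then additionally $T$ preserves admissible metrics. If the group $G$ is finite, then the operator $T$ is continuous with respect to the point-wise convergence of functions.
   Context: A $T_1$ topological space $Y$ is stratifiable if to each open $U\subset Y$ one can assign a sequence $(U_n)_{n\in\mathbb{N}}$ of open subsets of $Y$ such that $\overline{U_n}\subset U$ for all $n$, $\bigcup_n U_n=U$, and $U_n\subset V_n$ for all $n$ whenever $U\subset V$ are open. Actions are continuous left actions. For $Z\in\{X,Y\}$, $C(Z\times Z)$ is the linear lattice of continuous real-valued functions on $Z\times Z$ with the compact-open topology, and $$C_{inv}(Z\times Z)=\{f\in C(Z\times Z): f(gx,gy)=f(x,y)\text{ for all } g\in G,\ x,y\in Z\}$$ is the subspace of $G$-invariant functions. An operator $T:C_{inv}(X\times X)\to C_{inv}(Y\times Y)$ is positive if $T(p)\ge0$ whenever $p\ge0$, and is an extension operator if $T(p)|_{X\times X}=p$ for all $p$. ''$T$ preserves'' a class of functions means that $T$ carries every function in $C_{inv}(X\times X)$ of this class to a function in $C_{inv}(Y\times Y)$ of the same class; a constant function is carried to the constant function with the same value. Thus the metrics and pseudometrics considered here are continuous and invariant. A metric $d$ on a topological space $Z$ is dominating if the formal identity map $(Z,d)\to Z$ is continuous,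 and admissible if it is continuous and dominating. *)

(* Defs.v *)
From HB Require Import structures.
From mathcomp Require Import all_boot all_order all_algebra.
From mathcomp Require Import all_classical all_reals all_analysis.
Import Order.TTheory GRing.Theory Num.Theory.
Import numFieldNormedType.Exports.

Set Implicit Arguments.
Unset Strict Implicit.
Unset Printing Implicit Defensive.

Local Open Scope classical_set_scope.
Local Open Scope ring_scope.

(* Topological groups, written multiplicatively; no separation axiom. *)
HB.mixin Record isTopologicalGroup G & Group G & Topological G := {
  mulg_continuous : continuous (fun gh : G * G => (gh.1 * gh.2)%g);
  invg_continuous : continuous (fun g : G => g^-1%g)
}.

#[short(type="topologicalGroupType")]
HB.structure Definition TopologicalGroup :=
  { G of Group G & Topological G & isTopologicalGroup G }.

Definition stratifiable (Y : topologicalType) : Prop :=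
  accessible_space Y /\
  exists S : set Y -> nat -> set Y,
    [/\ forall U, open U -> forall n, open (S U n) /\ closure (S U n) `<=` U,
        forall U, open U -> \bigcup_n S U n = U &
        forall U V, open U -> open V -> U `<=` V ->
          forall n, S U n `<=` S V n].

Section actions.
Context {G : topologicalGroupType} {Y : topologicalType}.
Implicit Types (act : G -> Y -> Y) (X : set Y).

Definition continuous_action act : Prop :=
  [/\ forall y, act 1%g y = y,
      forall g h y, act (g * h)%g y = act g (act h y) &
      continuous (fun gy : G * Y => act gy.1 gy.2)].

Definition invariant_set act X : Prop := forall g x, X x -> X (act g x).

Definition sub_act act X (Xinv : invariant_set act X) (g : G) (x : X) : X :=
  exist _ (act g (\val x)) (mem_set (Xinv g (\val x) (set_valP x))).

End actions.

Section metrics.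
Context {R : realType}.

Definition is_pseudometric (Z : Type) (d : Z * Z -> R) : Prop :=
  [/\ forall x y, 0 <= d (x, y),
      forall x, d (x, x) = 0,
      forall x y, d (x, y) = d (y, x) &
      forall x y z, d (x, z) <= d (x, y) + d (y, z)].

Definition is_metric (Z : Type) (d : Z * Z -> R) : Prop :=
  is_pseudometric d /\ forall x y, d (x, y) = 0 -> x = y.

(* The neighborhoods of [x] in the metric space [(Z, d)]. *)
Definition metric_nbhs (Z : Type) (d : Z * Z -> R) (x : Z) : set_system Z :=
  filter_from [set e : R | 0 < e] (fun e => [set y | d (x, y) < e]).

(* Continuity of the identity map from [(Z, d)] to [Z] at every point. *)
Definition dominating (Z : topologicalType) (d : Z * Z -> R) : Prop :=
  forall x, id @ metric_nbhs d x --> x.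

Definition admissible_metric (Z : topologicalType) (d : Z * Z -> R) : Prop :=
  [/\ is_metric d, continuous d & dominating d].

End metrics.

Definition metrizable (R : realType) (Z : topologicalType) : Prop :=
  exists d : Z * Z -> R,
    is_metric d /\ forall x, nbhs x = metric_nbhs d x.

Section Cinv.
Context (R : realType) (G : Type) (Z : topologicalType) (act : G -> Z -> Z).

Definition Cinv_pred : {pred Z * Z -> R} :=
  mem [set f : Z * Z -> R | continuous f /\
    forall g x y, f (act g x, act g y) = f (x, y)].

Record Cinv := MkCinv { Cinv_fun :> Z * Z -> R ; _ : Cinv_fun \in Cinv_pred }.

HB.instance Definition _ := [isSub for Cinv_fun].
HB.instance Definition _ := [Choice of Cinv by <:].

Lemma Cinv_submod_closed : submod_closed Cinv_pred.
Proof.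
split; first by rewrite inE; split=> // z; exact: cvg_cst.
move=> a f h /[!inE] -[cf If] [ch Ih]; split=> [z|g x y].
  apply: (@cvgD _ R^o); last exact: ch.
  by apply: (@cvgZl_tmp _ R^o); exact: cf.
by rewrite /GRing.add /GRing.scale /= If Ih.
Qed.

HB.instance Definition _ := GRing.isSubmodClosed.Build R (Z * Z -> R)
  Cinv_pred Cinv_submod_closed.
HB.instance Definition _ := [SubChoice_isSubLmodule of Cinv by <:].

(* Two copies of [Cinv], with the subspace topologies inherited from the
   compact-open topology and from the topology of pointwise convergence. *)
Definition Cinv_compact_open : Type :=
  initial_topology (Cinv_fun : Cinv -> {compact-open, (Z * Z)%type -> R}).
HB.instance Definition _ := Topological.on Cinv_compact_open.

Definition Cinv_ptws : Type :=
  initial_topology (Cinv_fun : Cinv -> {ptws (Z * Z)%type -> R}).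
HB.instance Definition _ := Topological.on Cinv_ptws.

End Cinv.

(* Main.v *)
Require Import Defs.
From HB Require Import structures.
From mathcomp Require Import all_boot all_order all_algebra.
From mathcomp Require Import all_classical all_reals all_analysis.
From mathcomp Require wochoice.
From mathcomp Require Import ring lra.
Import Order.TTheory GRing.Theory Num.Theory.
Import numFieldNormedType.Exports.

Set Implicit Arguments.
Unset Strict Implicit.
Unset Printing Implicit Defensive.

Local Open Scope classical_set_scope.
Local Open Scope ring_scope.

(** The operator is an average over the compact group [G] of an operator for
    the trivial group, and the latter comes from a random retraction.

    Suppose that a random map [r] sends every point [y] of [Y] to a random
    point of [X], takes finitely many values at each [y], and fixes [X].  Then
    the expectation of [p (r y, r y')] is positive and linear in [p], extends
    [p], preserves constants and bounds, depends on finitely many values of [p]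
    at each [(y, y')], and is a pseudometric if [p] is one because it is an
    average of pullbacks of [p].  The random map of Hartman and Mycielski is a
    step function of a parameter [t] in the unit interval: [r y] takes the
    value [node n y] for [t] between the consecutive thresholds [tau n.+1 y]
    and [tau n.+2 y].  No integral is needed: the weight of a pair of values is
    the length of the intersection of two intervals, the mixed second
    difference of [Num.min] ([overlap]), and the triangle inequality follows
    by splitting along a third family of intervals ([pairing_triangle]).

    Such a map cannot separate points in general, for [X] may have two points
    while [Y] is huge.  So with probability [lambda y = tau 1 y], which
    vanishes exactly on [X], the value of [r y] is a symbol for [y] itself
    outside [X], and [p] is extended to the symbols from two points [a <> b]
    of [X]: the distance from a point to a symbol is the mean of its distances
    to [a] and to [b], and two symbols are at distance [d (y, y') * p (a, b)],
    where [d] is a continuous metric on [Y] bounded by one ([cone_ext]).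
    The combination is linear in [p], positive since [d] is at most one, and a
    metric if [p] is one ([pair_ext_metric]).

    The retraction must be continuous at the points of [X]: the nodes of [y]
    must tend to [x] when [y] tends to [x] in [X].  This is Dugundji's
    extension process, which Borges carried over to stratifiable spaces: cover
    the complement of [X] by open sets, each with a point of [X], such that the
    points attached to the sets near [x] are near [x] ([dugundji_cover]).
    Michael's argument for paracompactness turns any open cover into countably
    many continuous functions, each carrying a locally constant choice of a
    member of the cover on its support ([sigma_disjoint],
    [partition_functions]); they yield the thresholds, the nodes and [lambda].
    Applied to the covers by neighbourhoods that shrink to the points, the same
    lemma yields [d] ([stratified_metric]).  If [Y] is metrizable, one takes for
    [d] a bounded admissible metric, for [lambda] the distance to [X], and nodes
    whose distance to [y] is at most three times the distance from [y] to [X];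
    then a small value of the extension of an admissible metric forces the
    points to be close ([pair_ext_dominating]).

    Finally, an invariant mean on the continuous functions of [G] ([mean]),
    obtained from averages of finitely many translates, makes the extension
    invariant.  The mean is strictly positive, which preserves metrics, and if
    the mean of a function is small then so is one of its values, which
    together with the compactness of [G] preserves domination
    ([average_dominating]). *)

(** * Limits and neighbourhoods *)

Lemma cvg_sum_seq (R : realType) (I : Type) (r : seq I) (T : Type)
    (F : set_system T) {FF : Filter F} (f : I -> T -> R) (a : I -> R) :
  (forall i, f i x @[x --> F] --> a i) ->
  \sum_(i <- r) f i x @[x --> F] --> \sum_(i <- r) a i.
Proof. by move=> fa; apply: cvg_big => //; exact: add_continuous. Qed.

Lemma cvg_le_dist (R : realType) (T : Type) (F : set_system T) {FF : Filter F}
    (f g : T -> R) (l : R) :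
  (\forall x \near F, `|f x - l| <= g x) -> g x @[x --> F] --> (0 : R) ->
  f x @[x --> F] --> l.
Proof.
move=> fg g0; apply/cvgrPdist_le => e e0.
have /cvgr0_norm_le/(_ _ e0) := g0; apply: filterS2 fg => x H1 H2.
by rewrite distrC (le_trans H1) // (le_trans _ H2) // ler_norm.
Qed.

Lemma cvg_minr (R : realType) (T : Type) (F : set_system T) {FF : Filter F}
    (f g : T -> R) (a b : R) :
  f x @[x --> F] --> a -> g x @[x --> F] --> b ->
  Num.min (f x) (g x) @[x --> F] --> Num.min a b.
Proof.
move=> fa gb; rewrite minr_absE; under eq_cvg => x do rewrite minr_absE.
apply: (@cvgM R); last exact: cvg_cst.
apply: (@cvgB _ R^o); first exact: (@cvgD _ R^o).
by apply: (@cvg_norm _ R^o); exact: (@cvgB _ R^o).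
Qed.

Lemma pairl_continuous (A B : topologicalType) (x : A) : continuous (fun z : B => (x, z)).
Proof. by move=> z; apply: cvg_pair => /=; [exact: cvg_cst|exact: cvg_id]. Qed.

Lemma pairr_continuous (A B : topologicalType) (x : B) : continuous (fun z : A => (z, x)).
Proof. by move=> z; apply: cvg_pair => /=; [exact: cvg_id|exact: cvg_cst]. Qed.

Section nearby.
Context {Y : topologicalType}.
Implicit Types (A : set Y) (y : Y).

Lemma not_closureP A y : ~ closure A y <-> \forall z \near y, ~ A z.
Proof.
split=> [/existsNP[B /not_implyP[yB]]|H cA].
  move=> AB0; apply: filterS yB => z Bz Az; apply: AB0.
  by exists z.
by have [z [Az]] := cA _ H; apply.
Qed.

Lemma open_nearP A : open A <-> forall y, A y -> \forall z \near y, A z.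
Proof. by rewrite openE. Qed.

Lemma open_near A y : open A -> A y -> \forall z \near y, A z.
Proof. by move=> /open_nearP; exact. Qed.

End nearby.

Lemma open_of_near_set_type (Y : topologicalType) (X : set Y) (x : X) (O : set X) :
  nbhs x O -> exists V : set Y, [/\ open V, V (\val x) & forall x' : X, V (\val x') -> O x'].
Proof. by case=> B [/= [V oV <-]] Vx sub; exists V; split=> // x' Vx'; apply: sub. Qed.

Lemma near_set_type (Y : topologicalType) (X V : set Y) (x : X) :
  open V -> V (\val x) -> \forall x' \near x, V (\val x').
Proof.
move=> oV Vx; by exists (set_val @^-1` V); split=> //; exists V.
Qed.

Lemma near_finite (I : Type) (F : set_system I) (T : choiceType) (A : set T) (P : T -> I -> Prop) :
    Filter F -> finite_set A -> (forall t, A t -> \forall i \near F, P t i) ->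
  \forall i \near F, forall t, A t -> P t i.
Proof.
move=> FF /finite_seqP[s ->]; elim: s => [|t s IHs] H.
  by apply: nearW => i t; rewrite /= in_nil.
have := H t (mem_head _ _).
have : \forall i \near F, forall t, [set` s] t -> P t i.
  by apply: IHs => u us; apply: H; rewrite /= inE us orbT.
apply: filterS2 => i Hs Ht u /=; rewrite inE => /predU1P[->//|].
exact: Hs.
Qed.

(** * Overlaps of two subdivisions of the unit interval *)

Section overlaps.
Context {R : realType}.
Implicit Types (s : nat -> R) (F : nat -> nat -> R).

Definition subdivision s :=
  [/\ s 0%N = 0, forall n, s n <= s n.+1, forall n, s n <= 1 &
      exists N, s N = 1].

(** All intervals from the [rank s]-th on are empty. *)
Definition rank s : nat := xget 0%N [set N | s N = 1].

(** The length of the intersection of the [n]-th interval of [s] with the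
    [m]-th interval of [s']: the intervals starting at 0 that end at [s n] and
    at [s' m] meet in an interval of length [Num.min (s n) (s' m)]. *)
Definition overlap s s' n m :=
  Num.min (s n.+1) (s' m.+1) - Num.min (s n.+1) (s' m) -
  Num.min (s n) (s' m.+1) + Num.min (s n) (s' m).

(** The integral of [F n m] over the parameters [t] in the [n]-th interval of
    [s] and in the [m]-th interval of [s']. *)
Definition pairing s s' F :=
  \sum_(n < rank s) \sum_(m < rank s') overlap s s' n m * F n m.

Lemma rankP s : subdivision s -> s (rank s) = 1.
Proof. by move=> [_ _ _ [N sN]]; apply: (@xgetPex _ 0%N [set N | s N = 1]); exists N. Qed.

Lemma subdivision_homo s : subdivision s -> {homo s : n m / (n <= m)%N >-> n <= m}.
Proof. by move=> [_ s_incr _ _]; apply: homo_leq => // x y z; apply: le_trans. Qed.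

Lemma subdivision_ge0 s n : subdivision s -> 0 <= s n.
Proof. by move=> ss; have [<- _ _ _] := ss; apply: subdivision_homo. Qed.

Lemma subdivision1 s n N : subdivision s -> s N = 1 -> (N <= n)%N -> s n = 1.
Proof.
move=> ss sN Nn; apply/eqP; rewrite eq_le; have [_ _ -> _] := ss.
by rewrite -sN subdivision_homo.
Qed.

Lemma overlapC s s' n m : overlap s s' n m = overlap s' s m n.
Proof.
by rewrite /overlap !(minC (s _)) (addrAC (Num.min (s' m.+1) _)).
Qed.

Lemma min_incr2_ge0 (a b c d : R) : a <= b -> c <= d ->
  0 <= Num.min b d - Num.min b c - Num.min a d + Num.min a c.
Proof.
move=> ab cd.
by case: (ltP b d) => bd; case: (ltP b c) => bc; case: (ltP a d) => ad;
  case: (ltP a c) => ac; lra.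
Qed.

Lemma overlap_ge0 s s' n m : subdivision s -> subdivision s' ->
  0 <= overlap s s' n m.
Proof. by move=> [_ s1 _ _] [_ s2 _ _]; apply: min_incr2_ge0. Qed.

Lemma overlap_eq0l s s' n m : s n.+1 = s n -> overlap s s' n m = 0.
Proof. by rewrite /overlap => ->; ring. Qed.

Lemma overlap_eq0r s s' n m : s' m.+1 = s' m -> overlap s s' n m = 0.
Proof. by rewrite overlapC; apply: overlap_eq0l. Qed.

Lemma overlap_diag s n m : subdivision s -> n <> m -> overlap s s n m = 0.
Proof.
move=> ss; wlog nm : n m / (n < m)%N.
  move=> H nm; case: (ltngtP n m) => [|mn|//]; first by move=> ?; apply: H.
  by rewrite overlapC; apply: H => //; exact: nesym.
move=> _; have nm' := ltnW nm; have nm'' := leqW nm'.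
by rewrite /overlap !min_l ?subdivision_homo //; ring.
Qed.

Lemma sum_overlap s s' n N : subdivision s -> subdivision s' -> s' N = 1 ->
  \sum_(m < N) overlap s s' n m = s n.+1 - s n.
Proof.
move=> ss ss' s'N.
have [s0 _ s1 _] := ss; have [s'0 _ _ _] := ss'.
rewrite -(big_mkord xpredT (overlap s s' n)).
rewrite (eq_bigr (fun m => (Num.min (s n.+1) (s' m.+1) - Num.min (s n) (s' m.+1)) -
   (Num.min (s n.+1) (s' m) - Num.min (s n) (s' m)))).
  rewrite (@telescope_sumr _ 0 N (fun m => Num.min (s n.+1) (s' m) - Num.min (s n) (s' m))) //.
  by rewrite s'N s'0 !(@min_l _ _ _ 1) // !(@min_r _ _ _ 0) ?subdivision_ge0 //; ring.
by move=> m _; rewrite /overlap; ring.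
Qed.

Lemma pairing_widen s s' F N N' : subdivision s -> subdivision s' ->
    s N = 1 -> s' N' = 1 ->
  pairing s s' F = \sum_(n < N) \sum_(m < N') overlap s s' n m * F n m.
Proof.
move=> ss ss' sN s'N'.
have trunc (f : nat -> R) K M : (K <= M)%N -> (forall n, (K <= n)%N -> f n = 0) ->
    \sum_(n < M) f n = \sum_(n < K) f n.
  move=> KM f0; rewrite -!(big_mkord xpredT f) (big_cat_nat (n := K)) //=.
  rewrite [X in _ + X]big1_seq ?addr0 // => n.
  by rewrite mem_index_iota => /andP[_ /andP[/f0]].
have widen1 K M P : s K = 1 -> (K <= M)%N ->
    \sum_(n < M) \sum_(m < P) overlap s s' n m * F n m =
    \sum_(n < K) \sum_(m < P) overlap s s' n m * F n m.
  move=> sK KM; apply: (trunc (fun n => \sum_(m < P) overlap s s' n m * F n m)) => // n Kn.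
  apply: big1 => m _.
  by rewrite overlap_eq0l ?mul0r // !(subdivision1 ss sK) // (leq_trans Kn).
have widen2 K M P : s' K = 1 -> (K <= M)%N ->
    \sum_(n < P) \sum_(m < M) overlap s s' n m * F n m =
    \sum_(n < P) \sum_(m < K) overlap s s' n m * F n m.
  move=> sK KM; apply: eq_bigr => n _.
  apply: (trunc (fun m => overlap s s' n m * F n m)) => // m Km.
  by rewrite overlap_eq0r ?mul0r // !(subdivision1 ss' sK) // (leq_trans Km).
rewrite /pairing.
have [h|/ltnW h] := leqP (rank s') N';
  [rewrite -(widen2 (rank s') N') ?rankP //|rewrite (widen2 N' (rank s')) //];
  (have [k|/ltnW k] := leqP (rank s) N;
    [by rewrite -(widen1 (rank s) N) ?rankP|by rewrite (widen1 N (rank s))]).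
Qed.

Lemma pairingC s s' F : pairing s s' F = pairing s' s (fun n m => F m n).
Proof.
rewrite /pairing exchange_big; apply: eq_bigr => m _; apply: eq_bigr => n _.
by rewrite overlapC.
Qed.

Lemma eq_pairing s s' F G :
    (forall n m, overlap s s' n m <> 0 -> F n m = G n m) ->
  pairing s s' F = pairing s s' G.
Proof.
move=> FG; apply: eq_bigr => n _; apply: eq_bigr => m _.
by have [->|/eqP/FG ->//] := eqVneq (overlap s s' n m) 0; rewrite !mul0r.
Qed.

Lemma ler_pairing s s' F G : subdivision s -> subdivision s' ->
    (forall n m, 0 < overlap s s' n m -> F n m <= G n m) ->
  pairing s s' F <= pairing s s' G.
Proof.
move=> ss ss' FG; apply: ler_sum => n _; apply: ler_sum => m _.
have := overlap_ge0 n m ss ss'; rewrite le_eqVlt => /predU1P[<-|o0].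
  by rewrite !mul0r.
by rewrite ler_pM2l ?FG.
Qed.

Lemma pairingD s s' F G :
  pairing s s' (fun n m => F n m + G n m) = pairing s s' F + pairing s s' G.
Proof.
rewrite /pairing -big_split; apply: eq_bigr => n _; rewrite -big_split.
by apply: eq_bigr => m _; rewrite mulrDr.
Qed.

Lemma pairingZ s s' c F :
  pairing s s' (fun n m => c * F n m) = c * pairing s s' F.
Proof.
rewrite /pairing mulr_sumr; apply: eq_bigr => n _; rewrite mulr_sumr.
by apply: eq_bigr => m _; rewrite mulrCA.
Qed.

Lemma pairingB s s' F G :
  pairing s s' (fun n m => F n m - G n m) = pairing s s' F - pairing s s' G.
Proof.
rewrite pairingD -[in RHS]mulN1r -pairingZ; congr (_ + _).
by apply: eq_pairing => n m _; rewrite mulN1r.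
Qed.

(** What depends on one of the subdivisions only is integrated against the
    lengths of its own intervals, whatever the other subdivision is. *)
Lemma pairing_marginall s s' (f : nat -> R) : subdivision s -> subdivision s' ->
  pairing s s' (fun n _ => f n) = \sum_(n < rank s) (s n.+1 - s n) * f n.
Proof.
move=> ss ss'; apply: eq_bigr => n _.
by rewrite -mulr_suml sum_overlap ?rankP.
Qed.

Lemma pairing_cst s s' c : subdivision s -> subdivision s' ->
  pairing s s' (fun _ _ => c) = c.
Proof.
move=> ss ss'; rewrite pairing_marginall // -mulr_suml.
rewrite -(big_mkord xpredT (fun n => s n.+1 - s n)) telescope_sumr //.
by rewrite rankP //; have [-> _ _ _] := ss; rewrite subr0 mul1r.
Qed.

Lemma ler_norm_pairing s s' F G : subdivision s -> subdivision s' ->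
    (forall n m, 0 < overlap s s' n m -> `|F n m| <= G n m) ->
  `|pairing s s' F| <= pairing s s' G.
Proof.
move=> ss ss' FG; rewrite ler_norml -mulN1r -pairingZ.
by apply/andP; split; apply: ler_pairing => // n m /FG; rewrite ler_norml; lra.
Qed.

(** The length of the intersection of three intervals.  It is nonnegative
    because truncation to the third interval is monotone and commutes with
    [Num.min], so that it reduces to the case of two intervals. *)
Let overlap3 s1 s2 s3 n m k :=
  overlap s1 (fun m => Num.min (s2 m) (s3 k.+1)) n m -
  overlap s1 (fun m => Num.min (s2 m) (s3 k)) n m.

Let overlap3_ge0 s1 s2 s3 n m k : subdivision s1 -> subdivision s2 ->
  subdivision s3 -> 0 <= overlap3 s1 s2 s3 n m k.
Proof.
move=> [_ /(_ n) i1 _ _] [_ /(_ m) i2 _ _] [_ /(_ k) i3 _ _].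
rewrite /overlap3 /overlap.
move: (s1 n) (s1 n.+1) (s2 m) (s2 m.+1) (s3 k) (s3 k.+1) i1 i2 i3 => a b c d e f ab cd ef.
pose h x := Num.min x f - Num.min x e.
have hI : {homo h : x y / x <= y}.
  move=> x y xy; rewrite /h.
  by case: (ltP x f) => ?; case: (ltP x e) => ?; case: (ltP y f) => ?;
    case: (ltP y e) => ?; lra.
have hm x y : h (Num.min x y) = Num.min (h x) (h y).
  case: (leP x y) => xy; first by rewrite min_l // hI.
  by rewrite min_r // hI // ltW.
have := min_incr2_ge0 (hI _ _ ab) (hI _ _ cd).
by rewrite -!hm /h -!minA; lra.
Qed.

(** Each of the three overlaps is a sum of triple overlaps, so the inequality
    between the integrands carries over term by term. *)
Lemma pairing_triangle s1 s2 s3 F G H :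
    subdivision s1 -> subdivision s2 -> subdivision s3 ->
    (forall n m k, F n k <= G n m + H m k) ->
  pairing s1 s3 F <= pairing s1 s2 G + pairing s2 s3 H.
Proof.
move=> ss1 ss2 ss3 FGH.
have [s10 _ s11 _] := ss1; have [s20 _ s21 _] := ss2; have [s30 _ s31 _] := ss3.
have sum12 n m : \sum_(k < rank s3) overlap3 s1 s2 s3 n m k = overlap s1 s2 n m.
  rewrite -(big_mkord xpredT (overlap3 s1 s2 s3 n m)).
  rewrite (@telescope_sumr _ 0 _ (fun k => overlap s1 (fun m => Num.min (s2 m) (s3 k)) n m)) //.
  rewrite rankP // s30 [X in _ - X](_ : _ = 0).
    by rewrite subr0 /overlap !(@min_l _ _ (s2 _) 1).
  by rewrite /overlap !(@min_r _ _ (s2 _) 0) ?subdivision_ge0 //; ring.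
have sum13 n k : \sum_(m < rank s2) overlap3 s1 s2 s3 n m k = overlap s1 s3 n k.
  pose K m := (Num.min (s1 n.+1) (Num.min (s2 m) (s3 k.+1)) -
    Num.min (s1 n) (Num.min (s2 m) (s3 k.+1))) -
    (Num.min (s1 n.+1) (Num.min (s2 m) (s3 k)) -
    Num.min (s1 n) (Num.min (s2 m) (s3 k))).
  rewrite -(big_mkord xpredT (fun m => overlap3 s1 s2 s3 n m k)).
  rewrite (eq_bigr (fun m => K m.+1 - K m)); last first.
    by move=> m _; rewrite /overlap3 /overlap /K; ring.
  rewrite telescope_sumr // /K rankP // s20.
  rewrite !(@min_l _ _ 0) ?subdivision_ge0 // !(@min_r _ _ (s1 _) 0) ?subdivision_ge0 //.
  by rewrite !(@min_r _ _ 1) // /overlap; ring.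
have sum23 m k : \sum_(n < rank s1) overlap3 s1 s2 s3 n m k = overlap s2 s3 m k.
  pose K n := (Num.min (s1 n) (Num.min (s2 m.+1) (s3 k.+1)) -
    Num.min (s1 n) (Num.min (s2 m) (s3 k.+1))) -
    (Num.min (s1 n) (Num.min (s2 m.+1) (s3 k)) -
    Num.min (s1 n) (Num.min (s2 m) (s3 k))).
  rewrite -(big_mkord xpredT (fun n => overlap3 s1 s2 s3 n m k)).
  rewrite (eq_bigr (fun n => K n.+1 - K n)); last first.
    by move=> n _; rewrite /overlap3 /overlap /K; ring.
  rewrite telescope_sumr // /K rankP // s10.
  rewrite !(@min_l _ _ 0) ?le_min ?subdivision_ge0 // !(@min_r _ _ 1) ?ge_min ?s21 //.
  by rewrite /overlap; ring.
have -> : pairing s1 s3 F = \sum_(n < rank s1) \sum_(k < rank s3)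
    \sum_(m < rank s2) overlap3 s1 s2 s3 n m k * F n k.
  by apply: eq_bigr => n _; apply: eq_bigr => k _; rewrite -mulr_suml sum13.
have -> : pairing s1 s2 G = \sum_(n < rank s1) \sum_(k < rank s3)
    \sum_(m < rank s2) overlap3 s1 s2 s3 n m k * G n m.
  apply: eq_bigr => n _; rewrite exchange_big; apply: eq_bigr => m _.
  by rewrite -mulr_suml sum12.
have -> : pairing s2 s3 H = \sum_(n < rank s1) \sum_(k < rank s3)
    \sum_(m < rank s2) overlap3 s1 s2 s3 n m k * H m k.
  rewrite [RHS]exchange_big /= /pairing [LHS]exchange_big; apply: eq_bigr => k _.
  rewrite [RHS]exchange_big; apply: eq_bigr => m _.
  by rewrite -mulr_suml sum23.
rewrite -big_split; apply: ler_sum => n _; rewrite -big_split.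
apply: ler_sum => k _; rewrite -big_split; apply: ler_sum => m _ /=.
by rewrite -mulrDr ler_wpM2l ?overlap3_ge0.
Qed.

Lemma overlap_gt0 s s' n m : subdivision s -> subdivision s' ->
  0 < overlap s s' n m -> s n < s n.+1 /\ s' m < s' m.+1.
Proof.
move=> [_ si _ _] [_ s'i _ _] o0; rewrite !lt_neqAle si s'i !andbT; split.
  by apply: contraTN o0 => /eqP e; rewrite overlap_eq0l ?ltxx.
by apply: contraTN o0 => /eqP e; rewrite overlap_eq0r ?ltxx.
Qed.

Lemma pairing_ge_term s s' F n m : subdivision s -> subdivision s' ->
  (forall n m, 0 <= F n m) -> overlap s s' n m * F n m <= pairing s s' F.
Proof.
move=> ss ss' F0.
have term0 k l : 0 <= overlap s s' k l * F k l by rewrite mulr_ge0 ?overlap_ge0.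
have [nr|nr] := leqP (rank s) n; last have [mr|mr] := leqP (rank s') m.
- rewrite overlap_eq0l ?mul0r; first by apply: sumr_ge0 => ? _; exact: sumr_ge0.
  by rewrite !(subdivision1 ss (rankP ss)) // leqW.
- rewrite overlap_eq0r ?mul0r; first by apply: sumr_ge0 => ? _; exact: sumr_ge0.
  by rewrite !(subdivision1 ss' (rankP ss')) // leqW.
rewrite /pairing (bigD1 (Ordinal nr)) //= (bigD1 (Ordinal mr)) //=.
by rewrite -addrA lerDl addr_ge0 // sumr_ge0 // => *; exact: sumr_ge0.
Qed.

Lemma pairing_firstl s s' c : subdivision s -> subdivision s' ->
  pairing s s' (fun n _ => if n is 0%N then c else 0) = s 1%N * c.
Proof.
move=> ss ss'; rewrite (pairing_marginall (fun n => if n is 0%N then c else 0)) //.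
have := rankP ss; have [s0 _ _ _] := ss; case: (rank s) => [|r].
  by rewrite s0 => /eqP; rewrite eq_sym oner_eq0.
by rewrite big_ord_recl big1 => [|i _]; rewrite ?mulr0 // s0 subr0 addr0.
Qed.

Lemma pairing_firstr s s' c : subdivision s -> subdivision s' ->
  pairing s s' (fun _ m => if m is 0%N then c else 0) = s' 1%N * c.
Proof. by move=> ss ss'; rewrite pairingC pairing_firstl. Qed.

End overlaps.

(** * Invariant means on compact groups *)

Section haar_mean.
Context {R : realType} {G : topologicalGroupType}.
Hypothesis Gcompact : compact [set: G].
Implicit Types (f : G -> R) (hs ks : seq G).

Definition ravg hs f (g : G) : R :=
  (\sum_(h <- hs) f (g * h)%g) / (size hs)%:R.

Definition lavg hs f (g : G) : R :=
  (\sum_(h <- hs) f (h * g)%g) / (size hs)%:R.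

(** The upper bounds of the right averages of [f].  Their infimum is the common
    limit of the right averages of [f] that oscillate less and less. *)
Definition ravg_bounds f : set R :=
  [set M | exists2 hs, hs != [::] & forall g, ravg hs f g <= M].

Definition mean f : R := inf (ravg_bounds f).

Lemma mulg_continuous_r (h : G) : continuous (fun g : G => (g * h)%g).
Proof.
move=> g; apply: (@continuous_comp _ _ _ (fun g : G => (g, h)) (fun gh => (gh.1 * gh.2)%g)).
  by apply: cvg_pair => /=; [exact: cvg_id|exact: cvg_cst].
exact: mulg_continuous.
Qed.

Lemma size_gt0R hs : hs != [::] -> 0 < (size hs)%:R :> R.
Proof. by rewrite ltr0n lt0n size_eq0. Qed.

Lemma ravg_continuous hs f : continuous f -> continuous (ravg hs f).
Proof.
move=> cf g; apply: (@cvgM R); last exact: cvg_cst.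
apply: cvg_sum_seq => h.
apply: (@continuous_comp _ _ _ (fun g => (g * h)%g) f); last exact: cf.
exact: mulg_continuous_r.
Qed.

Lemma sum_cst_seq hs (M : R) : \sum_(h <- hs) M = M * (size hs)%:R.
Proof. by rewrite big_const_seq count_predT iter_addr_0 mulr_natr. Qed.

Lemma le_ravg hs f M : hs != [::] -> (forall g, f g <= M) ->
  forall g, ravg hs f g <= M.
Proof.
move=> hs0 fM g; rewrite ler_pdivrMr ?size_gt0R // -sum_cst_seq.
by rewrite ler_sum.
Qed.

Lemma ravgB hs f f' g :
  ravg hs (fun g => f g - f' g) g = ravg hs f g - ravg hs f' g.
Proof. by rewrite /ravg sumrB mulrBl. Qed.

Lemma ravgD hs f f' g :
  ravg hs (fun g => f g + f' g) g = ravg hs f g + ravg hs f' g.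
Proof. by rewrite /ravg big_split mulrDl. Qed.

Lemma ravgZ hs c f g : ravg hs (fun g => c * f g) g = c * ravg hs f g.
Proof. by rewrite /ravg -mulr_sumr mulrA. Qed.

Lemma ravgN hs f g : ravg hs (fun g => - f g) g = - ravg hs f g.
Proof. by rewrite /ravg sumrN mulNr. Qed.

Lemma ge_ravg hs f M : hs != [::] -> (forall g, M <= f g) ->
  forall g, M <= ravg hs f g.
Proof.
move=> hs0 fM g; rewrite -lerN2 -ravgN.
by apply: le_ravg => // k; rewrite lerN2.
Qed.

Lemma allpairs_neq0 hs ks : hs != [::] -> ks != [::] ->
  [seq (h * k)%g | h <- hs, k <- ks] != [::].
Proof. by case: hs ks => [//|h hs] [//|k ks]. Qed.

Lemma ravg_ravg hs ks f :
  ravg hs (ravg ks f) = ravg [seq (h * k)%g | h <- hs, k <- ks] f.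
Proof.
apply/funext => g; rewrite /ravg -mulr_suml size_allpairs natrM invfM mulrA.
rewrite mulrAC; congr (_ / _ / _).
rewrite big_allpairs_dep; apply: eq_bigr => h _; apply: eq_bigr => k _.
by rewrite mulgA.
Qed.

Lemma ravg_lavg hs ks f : ravg hs (lavg ks f) = lavg ks (ravg hs f).
Proof.
apply/funext => g; rewrite /ravg /lavg -!mulr_suml mulrAC; congr (_ / _ / _).
by rewrite exchange_big; apply: eq_bigr => k _; apply: eq_bigr => h _; rewrite mulgA.
Qed.

Lemma lavgE ks f g :
  lavg ks f g = ravg [seq k^-1%g | k <- ks] (fun h => f h^-1%g) g^-1%g.
Proof.
rewrite /lavg /ravg size_map big_map; congr (_ / _).
by apply: eq_bigr => k _; rewrite invgM !invgK.
Qed.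

Lemma le_lavg ks f M : ks != [::] -> (forall g, f g <= M) ->
  forall g, lavg ks f g <= M.
Proof. by move=> ks0 fM g; rewrite lavgE le_ravg //; case: ks ks0. Qed.

Lemma ge_lavg ks f M : ks != [::] -> (forall g, M <= f g) ->
  forall g, M <= lavg ks f g.
Proof. by move=> ks0 fM g; rewrite lavgE ge_ravg //; case: ks ks0. Qed.

(** Compactness is used through [near_covering], with the filter of the finite
    sequences that contain a given sequence. *)
Lemma translates_cover (V : set G) : nbhs 1%g V ->
  exists2 ks : seq G, ks != [::] & forall g, exists2 k, k \in ks & V (g * k^-1)%g.
Proof.
move=> V1.
pose F : set_system (seq G) :=
  filter_from setT (fun ks0 : seq G => [set ks : seq G | {subset ks0 <= ks}]).
have FF : Filter F.
  apply: filter_from_filter => [|ks1 ks2 _ _]; first by exists [::].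
  exists (ks1 ++ ks2) => // ks sub; split => k kks; apply: sub;
    by rewrite mem_cat kks ?orbT.
have /compact_near_coveringP := Gcompact.
move=> /(_ _ F (fun ks g => exists2 k, k \in ks & V (g * k^-1)%g) FF) [].
  move=> x _; exists ([set g | V (g * x^-1)%g], [set ks : seq G | x \in ks]); last first.
    by move=> [g ks] [/= Vg xks]; exists x.
  split; last by exists [:: x] => // ks; apply; exact: mem_head.
  have := @mulg_continuous_r x^-1%g x V; rewrite mulgV; exact.
move=> ks _ /(_ ks (fun _ => id)) H; exists ks.
  by have [k] := H 1%g I; case: (ks).
by move=> g; exact: H.
Qed.

(** The modulus is uniform under left translations, hence it is shared by all
    right averages of [f]. *)
Lemma left_unif_continuous f (e : R) : continuous f -> 0 < e ->
  \forall u \near (1%g : G), forall g, `|f (u * g)%g - f g| <= e.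
Proof.
move=> cf e0; have /compact_near_coveringP := Gcompact.
move=> /(_ _ (nbhs (1%g : G)) (fun u g => `|f (u * g)%g - f g| <= e)) H.
suff : \forall u \near (1%g : G), [set: G] `<=` [set g | `|f (u * g)%g - f g| <= e].
  by apply: filterS => u Hu g; exact: Hu.
apply: H => x _.
have c1 : (fun gu : G * G => f (gu.2 * gu.1)%g) @ (x, 1%g) --> f x.
  have -> : f x = f (1 * x)%g by rewrite mul1g.
  apply: (@continuous_comp _ _ _ (fun gu : G * G => (gu.2 * gu.1)%g) f (x, 1%g)); last exact: cf.
  apply: (@continuous_comp _ _ _ (fun gu : G * G => (gu.2, gu.1))
    (fun gh : G * G => (gh.1 * gh.2)%g)).
    by apply: cvg_pair => /=; [exact: cvg_snd|exact: cvg_fst].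
  exact: mulg_continuous.
have c2 : (fun gu : G * G => f gu.1) @ (x, 1%g) --> f x.
  apply: (@continuous_comp _ _ _ (fun gu : G * G => gu.1) f (x, 1%g)); last exact: cf.
  exact: cvg_fst.
have c3 : (fun gu : G * G => f (gu.2 * gu.1)%g - f gu.1) @ (x, 1%g) --> (0 : R).
  by rewrite -(subrr (f x)); exact: cvgB.
exact: cvgr0_norm_le c3 _ e0.
Qed.

Lemma compact_bounded_below f : continuous f -> exists M, forall g, M <= f g.
Proof.
move=> cf; have [ks ks0 kscov] := translates_cover (left_unif_continuous cf ltr01).
pose M := \sum_(k <- ks) `|f k| + 1.
exists (- M) => g; have [k kks /(_ k)] := kscov g.
rewrite mulgVK ler_norml => /andP[+ _].
have fkM : `|f k| + 1 <= M.
  by rewrite lerD2r (big_rem k kks) /= lerDl sumr_ge0.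
have := ler_norm (- f k); rewrite normrN.
lra.
Qed.

Lemma ravg_bounds_inf f : continuous f -> has_inf (ravg_bounds f).
Proof.
move=> cf; split.
  have [M fM] : exists M, forall g, - f g >= M.
    by apply: compact_bounded_below => g; apply: (@cvgN _ R^o); exact: cf.
  exists (- M), [:: 1%g] => // g; apply: le_ravg => // h.
  by rewrite lerNr.
have [M fM] := compact_bounded_below cf.
exists M => N [hs hs0 H]; apply: le_trans (H 1%g).
exact: ge_ravg.
Qed.

(** An average whose supremum is nearly minimal cannot oscillate by more than
    [e]: otherwise it is less than its supremum by [e / 2] on a translate of a
    fixed neighbourhood of 1, finitely many translates of which cover [G], and
    averaging over these translates lowers the supremum by [e / 2 / n], where
    [n] depends on [f] and [e] only. *)
Lemma ravg_almost_cst f (e : R) : continuous f -> 0 < e ->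
  exists2 hs, hs != [::] & forall g h, ravg hs f g - ravg hs f h <= e.
Proof.
move=> cf e0; have e20 : 0 < e / 2 by rewrite divr_gt0.
have /translates_cover [ks ks0 kscov] := left_unif_continuous cf e20.
have n0 := size_gt0R ks0; set n := (size ks)%:R : R in n0.
have en0 : 0 < e / 2 / n by rewrite !divr_gt0.
have [M [hs hs0 fM] Mlt] := inf_adherent en0 (ravg_bounds_inf cf).
exists hs => // g1 g0; rewrite leNgt; apply/negP => big.
(* the average [ravg hs f] is small around its low value at [g0] *)
have low u : (forall g, `|f (u * g)%g - f g| <= e / 2) ->
    ravg hs f (u * g0)%g <= M - e / 2.
  move=> Hu; have : ravg hs f (u * g0)%g - ravg hs f g0 <= e / 2.
    have -> : ravg hs f (u * g0)%g = ravg hs (fun g => f (u * g)%g) g0.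
      by congr (_ / _); apply: eq_bigr => h _; rewrite mulgA.
    rewrite -ravgB; apply: le_ravg => // g.
    by have := Hu g; rewrite ler_norml => /andP[].
  by have := fM g1; lra.
suff : ravg_bounds f (M - e / 2 / n).
  move=> /(ge_inf (ravg_bounds_inf cf).2); rewrite -/(mean f).
  by move: Mlt; rewrite -/(mean f); lra.
exists [seq (h * k)%g | h <- [seq (k^-1 * g0)%g | k <- ks], k <- hs].
  by rewrite allpairs_neq0 //; case: (ks) ks0.
move=> g; rewrite -ravg_ravg /ravg size_map -/n ler_pdivrMr // big_map.
have [k kks Hk] := kscov g.
rewrite (big_rem k kks) /= mulgA.
have := low _ Hk; rewrite /ravg => low1.
have : \sum_(y <- rem k ks) (\sum_(h <- hs) f (g * (y^-1 * g0) * h)%g) / (size hs)%:R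
    <= M * (n - 1).
  have -> : n - 1 = (size (rem k ks))%:R.
    rewrite size_rem // -subn1 natrB //; by case: (ks) kks.
  rewrite -sum_cst_seq; apply: ler_sum => y _; exact: fM.
have -> : (M - e / 2 / n) * n = M * n - e / 2 by rewrite mulrBl divfK ?gt_eqF.
lra.
Qed.

(** A left average of [f] that is almost constant exists, and it keeps the bounds
    [c] and [M], because left averages commute with right averages; so these
    bounds both apply to nearly the same constant. *)
Lemma ravg_cross f hs ks (c M : R) : continuous f -> hs != [::] -> ks != [::] ->
  (forall g, c <= ravg hs f g) -> (forall g, ravg ks f g <= M) -> c <= M.
Proof.
move=> cf hs0 ks0 fc fM; apply/ler_addgt0Pr => e e0.
have cf' : continuous (fun g => f g^-1%g).
  move=> g; apply: (@continuous_comp _ _ _ (fun g => g^-1%g) f); last exact: cf.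
  exact: invg_continuous.
have [ls ls0 H] := ravg_almost_cst cf' e0.
pose ls' := [seq l^-1%g | l <- ls].
have ls'0 : ls' != [::] by rewrite /ls'; case: (ls) ls0.
have L g h : lavg ls' f g - lavg ls' f h <= e.
  rewrite !lavgE -map_comp (_ : map _ ls = ls); first exact: H.
  by rewrite -[RHS]map_id; apply: eq_map => x /=; rewrite invgK.
have c1 : c <= ravg hs (lavg ls' f) 1%g by rewrite ravg_lavg ge_lavg.
have c2 : ravg ks (lavg ls' f) 1%g <= M by rewrite ravg_lavg le_lavg.
have : ravg hs (lavg ls' f) 1%g - ravg ks (lavg ls' f) 1%g <= e.
  rewrite lerBlDr; apply: le_ravg => // g; rewrite -lerBlDl.
  apply: ge_ravg => // h.
  by have := L g h; lra.
lra.
Qed.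

Lemma mean_unique f c : continuous f ->
  (forall e : R, 0 < e -> exists2 hs, hs != [::] &
    forall g, `|ravg hs f g - c| <= e) -> mean f = c.
Proof.
move=> cf H; apply/eqP; rewrite eq_le; apply/andP; split.
  apply/ler_addgt0Pr => e /H[hs hs0 He].
  apply: (ge_inf (ravg_bounds_inf cf).2); exists hs => // g.
  by have := He g; rewrite ler_norml; lra.
apply/ler_addgt0Pr => e e0; rewrite -lerBlDr.
apply: (lb_le_inf (ravg_bounds_inf cf).1) => M [ks ks0 HM].
have [hs hs0 He] := H _ e0.
apply: (ravg_cross cf hs0 ks0) => // g.
by have := He g; rewrite ler_norml; lra.
Qed.

Lemma mean_approx f (e : R) : continuous f -> 0 < e ->
  exists2 hs, hs != [::] & forall g, `|ravg hs f g - mean f| <= e.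
Proof.
move=> cf e0; have [hs hs0 H] := ravg_almost_cst cf e0; exists hs => // g.
rewrite ler_norml; apply/andP; split.
  rewrite lerBrDr addrC -lerBrDr opprK; apply: (ge_inf (ravg_bounds_inf cf).2); exists hs => // h.
  by have := H h g; lra.
rewrite lerBlDl -lerBlDr; apply: (lb_le_inf (ravg_bounds_inf cf).1) => M [ks ks0 HM].
apply: (ravg_cross cf hs0 ks0) => // h.
by have := H g h; lra.
Qed.

Lemma mean_ge f c : continuous f -> (forall g, c <= f g) -> c <= mean f.
Proof.
move=> cf fc; apply: (lb_le_inf (ravg_bounds_inf cf).1) => M [ks ks0 HM].
by apply: le_trans (HM 1%g); apply: ge_ravg.
Qed.

Lemma mean_le f c : continuous f -> (forall g, f g <= c) -> mean f <= c.
Proof.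
move=> cf fc; apply: (ge_inf (ravg_bounds_inf cf).2).
by exists [:: 1%g] => //; apply: le_ravg.
Qed.

Lemma mean_norm_le f c : continuous f -> (forall g, `|f g| <= c) -> `|mean f| <= c.
Proof.
move=> cf fc; rewrite ler_norml; apply/andP; split.
  by apply: mean_ge => // g; have := fc g; rewrite ler_norml => /andP[].
by apply: mean_le => // g; have := fc g; rewrite ler_norml => /andP[].
Qed.

Lemma mean_cst c : mean (fun=> c) = c.
Proof.
have cc : continuous (fun _ : G => c) by move=> g; exact: cvg_cst.
by apply/eqP; rewrite eq_le mean_le // mean_ge.
Qed.

Lemma meanD f f' : continuous f -> continuous f' ->
  mean (fun g => f g + f' g) = mean f + mean f'.
Proof.
move=> cf cf'; apply: mean_unique.
  by move=> g; apply: (@cvgD _ R^o); [exact: cf|exact: cf'].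
move=> e e0; have e20 : 0 < e / 2 by rewrite divr_gt0.
have [hs hs0 H] := mean_approx cf e20.
have cF := ravg_continuous (hs := hs) cf'.
have [ks ks0 K] := mean_approx cF e20.
have -> : mean f' = mean (ravg hs f').
  apply: mean_unique => // d d0; have [ls ls0 L] := mean_approx cF d0.
  by exists [seq (h * k)%g | h <- ls, k <- hs]; rewrite ?allpairs_neq0 // -ravg_ravg.
exists [seq (h * k)%g | h <- ks, k <- hs]; first by rewrite allpairs_neq0.
move=> g; rewrite ravgD -!ravg_ravg.
have := K g; rewrite !ler_norml => /andP[k1 k2].
have : mean f - e / 2 <= ravg ks (ravg hs f) g.
  by apply: ge_ravg => // h; have := H h; rewrite ler_norml; lra.
have : ravg ks (ravg hs f) g <= mean f + e / 2.
  by apply: le_ravg => // h; have := H h; rewrite ler_norml; lra.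
lra.
Qed.

Lemma meanZ c f : continuous f -> mean (fun g => c * f g) = c * mean f.
Proof.
move=> cf; apply: mean_unique.
  by move=> g; apply: (@cvgM R); [exact: cvg_cst|exact: cf].
move=> e e0; have c0 : 0 < `|c| + 1 by rewrite ltr_wpDl.
have ec0 : 0 < e / (`|c| + 1) by rewrite divr_gt0.
have [hs hs0 H] := mean_approx cf ec0; exists hs => // g.
rewrite ravgZ -mulrBr normrM (le_trans (ler_wpM2l _ (H g))) //.
rewrite mulrCA ger_pMr // ler_pdivrMr // mul1r; lra.
Qed.

Lemma mean_monotone f f' : continuous f -> continuous f' ->
  (forall g, f g <= f' g) -> mean f <= mean f'.
Proof.
move=> cf cf' ff'; rewrite -subr_ge0 -mulN1r -meanZ // -meanD //; last first.
  by move=> g; apply: (@cvgM R); [exact: cvg_cst|exact: cf].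
apply: mean_ge => [g|g]; last by rewrite mulN1r subr_ge0.
apply: (@cvgD _ R^o); first exact: cf'.
by apply: (@cvgM R); [exact: cvg_cst|exact: cf].
Qed.

Lemma mean_translate f h : continuous f -> mean (fun g => f (g * h)%g) = mean f.
Proof.
move=> cf; apply: mean_unique.
  move=> g; apply: (@continuous_comp _ _ _ (fun g => (g * h)%g) f); last exact: cf.
  exact: mulg_continuous_r.
move=> e e0; have [hs hs0 H] := mean_approx cf e0.
exists [seq (k * h^-1)%g | k <- hs]; first by case: (hs) hs0.
move=> g; apply: le_trans (H g); rewrite le_eqVlt; apply/orP; left; apply/eqP.
congr (`|_ - _|); rewrite /ravg size_map big_map; congr (_ / _).
by apply: eq_bigr => k _; rewrite -mulgA mulgVK.
Qed.

Lemma mean_gt0 f : continuous f -> (forall g, 0 <= f g) -> 0 < f 1%g -> 0 < mean f.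
Proof.
move=> cf f0 f1.
have : \forall g \near (1%g : G), f 1%g / 2 < f g.
  by apply: cvgr_gt (cf 1%g) _ _; rewrite ltr_pdivrMr // mulr_natr mulr2n ltrDl.
move=> /translates_cover[ks ks0 kscov].
have n0 := size_gt0R ks0.
apply: (@lt_le_trans _ _ (f 1%g / 2 / (size ks)%:R)).
  by rewrite !divr_gt0.
apply: (lb_le_inf (ravg_bounds_inf cf).1) => M [hs hs0 HM].
have ks'0 : [seq k^-1%g | k <- ks] != [::] by case: (ks) ks0.
apply: (ravg_cross cf ks'0 hs0) => // g.
have [k kks /ltW Hk] := kscov g.
rewrite /ravg size_map ler_pM2r ?invr_gt0 // big_map (big_rem k kks) /=.
by rewrite (le_trans Hk) // lerDl sumr_ge0.
Qed.

End haar_mean.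

(** * Stratifiable spaces: normality and sigma-disjoint refinements *)

(** The well-ordering theorem in the form of a minimum for every nonempty set,
    with values in [Prop] to suit sets that are not decidable. *)
Lemma ex_well_order (I : choiceType) : exists R : I -> I -> Prop,
  [/\ forall x y z, R x y -> R y z -> R x z,
      forall x y, R x y -> R y x -> x = y &
      forall P : set I, P !=set0 -> exists2 m, P m & forall j, P j -> R m j].
Proof.
have [R wo] := wochoice.well_ordering_principle I.
have min (P : set I) : P !=set0 -> exists2 m, P m & forall j, P j -> R m j.
  move=> [p Pp]; have [|m [[Pm mP] _]] := wo (mem P); first by exists p; rewrite inE.
  by exists m => [|j Pj]; [move: Pm; rewrite inE|apply: mP; rewrite inE].
have anti x y : R x y -> R y x -> x = y.
  have wo' : wochoice.wo_chain R predT by move=> A _; exact: wo.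
  move=> xy yx; apply: (wochoice.wo_chain_antisymmetric wo') => //.
  by rewrite xy yx.
exists R; split=> // x y z xy yz.
have [|m] := min [set t | [\/ t = x, t = y | t = z]]; first by exists x; exact: Or31.
case=> -> H; first by apply: H; exact: Or33.
- by rewrite (anti x y) //; apply: H; exact: Or31.
- by rewrite -(anti y z) //; apply: H; exact: Or32.
Qed.

Definition stratification (Y : topologicalType) (S : set Y -> nat -> set Y) :=
  [/\ forall U, open U -> forall n, open (S U n) /\ closure (S U n) `<=` U,
      forall U, open U -> \bigcup_n S U n = U &
      forall U V, open U -> open V -> U `<=` V -> forall n, S U n `<=` S V n].

Section stratified.
Context {Y : topologicalType}.
Variable S : set Y -> nat -> set Y.
Hypothesis T1 : accessible_space Y.
Hypothesis SS : stratification S.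

Let S_open U : open U -> forall n, open (S U n) /\ closure (S U n) `<=` U.
Proof. by case: SS => H _ _; exact: H. Qed.

Let S_cover U : open U -> \bigcup_n S U n = U.
Proof. by case: SS => _ H _; exact: H. Qed.

Let S_mono U V : open U -> open V -> U `<=` V -> forall n, S U n `<=` S V n.
Proof. by case: SS => _ _ H; exact: H. Qed.

Lemma stratum U y : open U -> U y -> exists n, S U n y.
Proof. by move=> oU; rewrite -{1}(S_cover oU) => -[n _]; exists n. Qed.

Lemma stratum_closed U n y : open U -> ~ U y -> \forall z \near y, ~ S U n z.
Proof.
by move=> oU Uy; apply/not_closureP => cS; apply: Uy; exact: (S_open oU n).2.
Qed.

Lemma stratum_sub U n : open U -> S U n `<=` U.
Proof. by move=> oU; apply: subset_trans (S_open oU n).2; exact: subset_closure. Qed.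

Lemma near_stratum U n y : open U -> S U n y -> \forall z \near y, S U n z.
Proof. by by move=> oU; apply: open_near; exact: (S_open oU n).1. Qed.

Lemma near_not_strata U n y : open U -> ~ U y ->
  \forall z \near y, forall k, (k <= n)%N -> ~ S U k z.
Proof.
move=> oU Uy; have : \forall z \near y, forall k : 'I_n.+1, ~ S U k z.
  by apply: filter_forall => k; exact: stratum_closed.
apply: filterS => z H k kn.
exact: (H (Ordinal (kn : (k < n.+1)%N))).
Qed.

Lemma openC1 (w : Y) : open (~` [set w]).
Proof. by rewrite openC; exact: accessible_closed_set1. Qed.

(** The stratum of the complement of one closed set, minus the closures of the
    earlier strata of the complement of the other. *)
Lemma stratified_normal (R : realType) : normal_space Y.
Proof.
apply/(@normal_openP R) => A B cA cB AB0.
have sub C D : C `&` D = set0 -> forall y : Y, C y -> ~ D y.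
  by move=> CD0 y Cy Dy; have : set0 y by rewrite -CD0.
have nA := closed_openC cA; have nB := closed_openC cB.
pose U := [set y | exists n, S (~` B) n y /\
  \forall z \near y, forall k, (k <= n)%N -> ~ S (~` A) k z].
have oU : open U.
  apply/open_nearP => y [n [Sy /near_join Hy]].
  have := near_stratum nB Sy; apply: filterS2 Hy => z Hz Sz.
  by exists n.
exists U, (~` closure U); split=> //.
- by rewrite openC; exact: closed_closure.
- move=> y Ay; have [n Sn] := stratum nB (sub _ _ AB0 y Ay).
  by exists n; split => //; apply: near_not_strata => //; apply; exact: Ay.
- move=> y By; have nAy : (~` A) y by move=> Ay; exact: sub _ _ AB0 y Ay By.
  apply/not_closureP; have [n Sn] := stratum nA nAy.
  have Sn' := near_stratum nA Sn.
  have nBy : ~ (~` B) y by apply.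
  apply: filterS2 Sn' (near_not_strata n nB nBy) => z Sz Hz [k [Skz /nbhs_singleton Hk]].
  have [kn|/ltnW nk] := leqP k n; first exact: Hz Skz.
  exact: Hk Sz.
- apply/disjoints_subset; rewrite setCK; exact: subset_closure.
Qed.

(** A neighbourhood of [w] that shrinks as [n] grows.  Its use is [shadowP]: if
    it meets an early stratum of an open set, then [w] belongs to that set. *)
Definition shadow n w : set Y :=
  [set z | \forall t \near z, forall k, (k <= n)%N -> ~ S (~` [set w]) k t].

Lemma shadow_open n w : open (shadow n w).
Proof. by apply/open_nearP => z; apply: near_join. Qed.

Lemma shadow_center n w : shadow n w w.
Proof. by apply: near_not_strata; [exact: openC1|apply]. Qed.

Lemma shadowP U n k w z : open U -> S U k z -> (k <= n)%N -> shadow n w z -> U w.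
Proof.
move=> oU Sz kn /nbhs_singleton/(_ k kn) H; apply: contrapT => Uw; apply: H.
by apply: S_mono Sz => //; [exact: openC1|move=> t Ut tw; apply: Uw; rewrite -tw].
Qed.

(** The point [y] is assigned to a member of the cover whose stratum of least
    possible order contains it.  The order is locally bounded, so that the
    closure of the points assigned to the indices in [A] is controlled by
    finitely many strata of the union of the members with indices in [A]. *)
Lemma cushioned (I : choiceType) (i0 : I) (U : I -> set Y) :
    (forall i, open (U i)) ->
  exists pi : Y -> I, forall y, (exists i, U i y) -> forall A : set I,
    closure [set z | (exists i, U i z) /\ A (pi z)] y -> exists2 i, A i & U i y.
Proof.
move=> oU.
have /choice[pi piP] : forall y, exists i, (exists i, U i y) ->
    exists n, S (U i) n y /\ forall m j, S (U j) m y -> (n <= m)%N.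
  move=> y; have [[i Ui]|nU] := pselect (exists i, U i y); last by exists i0.
  have ex : exists n, `[< exists j, S (U j) n y >].
    by have [n Sn] := stratum (oU i) Ui; exists n; apply/asboolP; exists i.
  case: (ex_minnP ex) => n /asboolP[j Sj] mn; exists j => _; exists n; split=> // m k Sk.
  by apply: mn; apply/asboolP; exists k.
exists pi => y [i Ui] A cA.
pose UA := \bigcup_(i in A) U i.
have oUA : open UA by apply: bigcup_open => j _; exact: oU.
suff [j Aj Uj] : UA y by exists j.
apply: contrapT => nUA; move: cA; apply/not_closureP.
have [n Sn] := stratum (oU i) Ui.
apply: filterS2 (near_stratum (oU i) Sn) (near_not_strata n oUA nUA) => z Sz Hz.
move=> [/piP[m [Sm mmin]] Apiz]; have mn := mmin _ _ Sz.
apply: (Hz m mn); apply: S_mono Sm => //.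
by apply: bigcup_sup.
Qed.

(** Michael's argument.  The [k.+1]-st assignment is cushioned in the sets
    [U a] from which the closure of the points assigned by the [k]-th one to
    indices before [a] has been removed.  If [k] is a stage where the index
    assigned to [y] is least, then near [y] the next assignment can be neither
    greater (by the sets that were removed) nor smaller (by minimality), so it
    is locally constant. *)
Lemma sigma_disjoint (I : choiceType) (i0 : I) (U : I -> set Y) :
    (forall i, open (U i)) ->
  exists pi : nat -> Y -> I, forall y, (exists i, U i y) ->
    (forall k, U (pi k y) y) /\ exists k, \forall z \near y, pi k z = pi k y.
Proof.
move=> oU; have [le [le_trans le_anti le_min]] := ex_well_order I.
have /choice[c cP] : forall V : I -> set Y, exists pi : Y -> I,
    (forall i, open (V i)) -> forall y, (exists i, V i y) -> forall A : set I,
    closure [set z | (exists i, V i z) /\ A (pi z)] y -> exists2 i, A i & V i y.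
  move=> V; have [oV|noV] := pselect (forall i, open (V i)).
    by have [pi piP] := cushioned i0 oV; exists pi.
  by exists (fun=> i0).
pose W := [set y | exists i, U i y].
pose bad V a := [set z | W z /\ ~ le a (c V z)].
pose V_ := fix V_ k : I -> set Y := if k is k'.+1 then
  fun a => U a `\` closure (bad (V_ k') a) else U.
have Vsub k a : V_ k a `<=` U a by case: k => // k y [].
have oV k a : open (V_ k a).
  case: k => [|k]; first exact: oU.
  rewrite /= setDE; apply: openI; [exact: oU|rewrite openC; exact: closed_closure].
have VW k y : W y -> exists a, V_ k a y.
  elim: k y => [//|k IHk] y Wy.
  have [a Ua amin] := le_min [set i | U i y] Wy.
  exists a; split=> // cb.
  have [|b nab Vb] := cP (V_ k) (oV k) y (IHk y Wy) [set b | ~ le a b].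
    apply: closureS cb => z [Wz nle]; split=> //; exact: IHk.
  by apply: nab; apply: amin; exact: Vsub Vb.
have VWE k y : (exists a, V_ k a y) -> W y by move=> [a /Vsub Ua]; exists a.
have VPi k y (A : set I) : W y ->
    closure [set z | W z /\ A (c (V_ k) z)] y -> exists2 i, A i & V_ k i y.
  move=> Wy cA; apply: (cP (V_ k) (oV k) y (VW k y Wy)).
  by apply: closureS cA => z [Wz Az]; split=> //; exact: VW.
have Vpi k y : W y -> V_ k (c (V_ k) y) y.
  move=> Wy; have [|_ -> //] := VPi k y [set c (V_ k) y] Wy.
  by apply: subset_closure; split.
have oW : open W.
  rewrite (_ : W = \bigcup_i U i); first by apply: bigcup_open => i _; exact: oU.
  by apply/seteqP; split=> y [i]; exists i.
exists (fun k => c (V_ k)) => y Wy; split; first by move=> k; apply: Vsub; exact: Vpi.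
have [|_ [k _ <-] kmin] := le_min (range (fun k => c (V_ k) y)).
  by exists (c (V_ 0%N) y), 0%N.
set a := c (V_ k) y in kmin.
exists k.+1.
have up : \forall z \near y, ~ (W z /\ ~ le (c (V_ k.+1) z) a).
  apply/not_closureP => /(VPi k.+1 y [set g | ~ le g a] Wy)[g nga [_]]; apply.
  by apply: subset_closure.
have low : \forall z \near y, ~ (W z /\ ~ le a (c (V_ k.+1) z)).
  apply/not_closureP => cb.
  have [_] := Vpi k.+2 y Wy; apply; apply: closureS cb => z [Wz nle]; split=> //.
  apply: contra_not nle => /(le_trans _ _ _ _); apply; apply: kmin.
  by exists k.+2.
have ca : \forall z \near y, c (V_ k.+1) z = a.
  have := open_near oW Wy; apply: filterS3 up low => z H1 H2 Wz.
  by apply: le_anti; apply: contrapT => H; [apply: H1|apply: H2].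
apply: filterS (ca) => z ->; exact/esym/(nbhs_singleton ca).
Qed.

End stratified.

(** * Functions subordinate to an open cover *)

Section partition_functions.
Context {R : realType} {Y : topologicalType}.
Variable S : set Y -> nat -> set Y.
Hypothesis SS : stratification S.

(** The function of Urysohn's lemma is cut off below one half, so that it
    vanishes near each point where it vanishes outside [U]. *)
Lemma stratum_function (U : set Y) n : open U -> exists f : Y -> R,
  [/\ continuous f, forall y, 0 <= f y <= 1, forall y, 0 < f y -> U y,
      forall y, S U n y -> 0 < f y &
      forall y, ~ U y -> \forall z \near y, f z = 0].
Proof.
move=> oU; have [SUo _ _] := SS.
have US : uniform_separator (~` U) (closure (S U n)).
  apply: (normal_separatorP (R := R)).1 (stratified_normal SS R) _ _ _ _ _.
  - exact: open_closedC.
  - exact: closed_closure.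
  - by apply/disjoints_subset; apply: subsetC; exact: (SUo U oU n).2.
have [f [cf f01 f0 f1]] := (@uniform_separatorP _ R _ _).1 US.
have f0' y : ~ U y -> f y = 0 by move=> Uy; apply: f0; exists y.
have f1' y : S U n y -> f y = 1 by move=> Sy; apply: f1; exists y => //; exact: subset_closure.
have f01' y : 0 <= f y <= 1 by have := f01 (f y) (ex_intro2 _ _ y I erefl); rewrite /= in_itv.
exists (fun y => (`|f y * 2 - 1| + (f y * 2 - 1)) / 2); split.
- have c1 : continuous (fun y => f y * 2 - 1).
    move=> y; apply: (@cvgB _ R^o); last exact: cvg_cst.
    by apply: (@cvgM R); [exact: cf|exact: cvg_cst].
  move=> y; apply: (@cvgM R); last exact: cvg_cst.
  by apply: (@cvgD _ R^o); [apply: (@cvg_norm _ R^o)|]; exact: c1.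
- move=> y; have := f01' y; case: (ger0P (f y * 2 - 1)); lra.
- move=> y; apply: contraPP => /f0' ->; rewrite mul0r sub0r normrN normr1; lra.
- move=> y /f1' ->; rewrite ger0_norm; lra.
- move=> y /f0' f0y; have : \forall z \near y, f z < 1 / 2.
    by apply: cvgr_lt (cf y) _ _; rewrite f0y; lra.
  by apply: filterS => z fz; rewrite ler0_norm; lra.
Qed.

(** Countably many functions suffice, although the cover is arbitrary: [psi k]
    is subordinate to a disjoint family of open sets, and [pi k] says which
    one of them contains the point.  The alternative holds at every [y], also
    where the disjoint family is not locally finite. *)
Lemma partition_functions (I : choiceType) (i0 : I) (U : I -> set Y) :
    (forall i, open (U i)) ->
  exists (psi : nat -> Y -> R) (pi : nat -> Y -> I),
  [/\ forall k, continuous (psi k), forall k y, 0 <= psi k y <= 1,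
      forall k y, 0 < psi k y -> U (pi k y) y,
      forall k y, \forall z \near y, psi k z = 0 \/ pi k z = pi k y &
      forall y, (exists i, U i y) -> exists k, 0 < psi k y].
Proof.
move=> oU; have [pi piP] := sigma_disjoint SS i0 oU.
pose W := [set y | exists i, U i y].
have oW : open W.
  rewrite (_ : W = \bigcup_i U i); first by apply: bigcup_open => i _; exact: oU.
  by apply/seteqP; split=> y [i]; exists i.
pose O k := [set y | W y /\ \forall z \near y, pi k z = pi k y].
have oO k : open (O k).
  apply/open_nearP => y [Wy cy]; have := near_join cy.
  apply: filterS3 (cy) (open_near oW Wy) => z cz Wz ccz; split=> //.
  by apply: filterS ccz => t; rewrite cz.
have [S0 Scov _] := SS.
have /choice[f fP] : forall km : nat * nat, exists f : Y -> R,
  [/\ continuous f, forall y, 0 <= f y <= 1, forall y, 0 < f y -> O km.1 y,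
      forall y, S (O km.1) km.2 y -> 0 < f y &
      forall y, ~ O km.1 y -> \forall z \near y, f z = 0].
  by move=> km; exact: stratum_function.
pose idx k : nat * nat := odflt (0, 0)%N (unpickle k).
exists (fun k => f (idx k)), (fun k => pi (idx k).1); split.
- by move=> k; have [] := fP (idx k).
- by move=> k; have [] := fP (idx k).
- move=> k y; have [_ _ H _ _] := fP (idx k) => /H[Wy _].
  by have [+ _] := piP y Wy; exact.
- move=> k y; have [_ _ _ _ H] := fP (idx k).
  have [[Wy]|/H] := pselect (O (idx k).1 y); first by apply: filterS => z; right.
  by apply: filterS => z; left.
- move=> y Wy; have [_ [k ky]] := piP y Wy.
  have : O k y by [].
  rewrite -{1}(Scov _ (oO k)) => -[n _ Sn]; exists (pickle (k, n)).
  rewrite /idx pickleK /=; have [_ _ _ H _] := fP (k, n); exact: H.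
Qed.

End partition_functions.

(** A supremum instead of a series: it preserves pseudometrics, and at each
    point only finitely many terms matter up to a given error. *)
Section weighted_sup.
Context {R : realType} {T : Type}.
Variable h : nat -> T -> R.
Hypothesis h01 : forall k z, 0 <= h k z <= 1.

Definition wsup z : R := sup (range (fun k => h k z / k.+1%:R)).

Let term01 k z : 0 <= h k z / k.+1%:R <= 1.
Proof.
have /andP[h0 h1] := h01 k z; rewrite divr_ge0 //= ler_pdivrMr ?ltr0n // mul1r.
by rewrite (le_trans h1) // ler1n.
Qed.

Lemma wsup_has_sup z : has_sup (range (fun k => h k z / k.+1%:R)).
Proof.
split; first by exists (h 0%N z / 1%:R), 0%N.
by exists 1 => _ [k _ <-]; have /andP[] := term01 k z.
Qed.

Lemma ge_wsup k z : h k z / k.+1%:R <= wsup z.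
Proof. by apply: (ub_le_sup (wsup_has_sup z).2); exists k. Qed.

Lemma wsup_le z c : (forall k, h k z / k.+1%:R <= c) -> wsup z <= c.
Proof. by move=> hc; apply: (ge_sup (wsup_has_sup z).1) => _ [k _ <-]. Qed.

Lemma wsup_gt z c : c < wsup z -> exists k, c < h k z / k.+1%:R.
Proof.
move=> cz; have [|_ [k _ <-]] := sup_adherent _ (wsup_has_sup z) (eps := wsup z - c).
  by rewrite subr_gt0.
by rewrite -/(wsup z) opprB addrC subrK; exists k.
Qed.

Lemma wsup01 z : 0 <= wsup z <= 1.
Proof.
rewrite (le_trans _ (ge_wsup 0 z)); last by have /andP[] := term01 0 z.
by apply: wsup_le => k; have /andP[] := term01 k z.
Qed.

Lemma wsup_gt0 z : 0 < wsup z <-> exists k, 0 < h k z.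
Proof.
split=> [/wsup_gt[k]|[k hk]]; first by rewrite pmulr_lgt0 ?invr_gt0 //; exists k.
by apply: lt_le_trans (ge_wsup k z); rewrite divr_gt0.
Qed.

End weighted_sup.

Lemma wsup_continuous (R : realType) (T : topologicalType) (h : nat -> T -> R) :
    (forall k z, 0 <= h k z <= 1) -> (forall k, continuous (h k)) ->
  continuous (wsup h).
Proof.
move=> h01 ch z; apply/cvgrPdist_le => e e0.
have [N _ /(_ N (leqnn _)) /= Ne] := near_infty_natSinv_lt (PosNum e0).
have : \forall t \near z, forall k : 'I_N, `|h k z - h k t| <= e.
  by apply: filter_forall => k; have /cvgrPdist_le := ch k z; exact.
apply: filterS => t H.
have close u v : (forall k : 'I_N, `|h k u - h k v| <= e) -> wsup h v <= wsup h u + e.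
  move=> Huv; apply: wsup_le => // k; have [kN|Nk] := ltnP k N.
    have := Huv (Ordinal kN); rewrite ler_norml /= => /andP[H1 _].
    apply: (@le_trans _ _ ((h k u + e) / k.+1%:R)).
      by rewrite ler_pM2r ?invr_gt0 //; lra.
    rewrite mulrDl lerD ?ge_wsup // ler_pdivrMr // ler_peMr ?ler1n //; exact: ltW.
  have /andP[h0 h1] := h01 k v; have /andP[w0 _] := wsup01 h01 u.
  apply: (@le_trans _ _ (1 / k.+1%:R)); first by rewrite ler_pM2r ?invr_gt0.
  apply: (@le_trans _ _ e); last by rewrite lerDr.
  by rewrite div1r (le_trans _ (ltW Ne)) // lef_pV2 ?posrE // ler_nat.
rewrite ler_norml; have := close z t H.
have : wsup h z <= wsup h t + e by apply: close => k; rewrite distrC.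
lra.
Qed.

Section hedgehog.
Context {R : realType} {Y : topologicalType} {I : choiceType}.
Variables (psi : Y -> R) (pi : Y -> I).
Hypothesis psi01 : forall y, 0 <= psi y <= 1.

(** The metric of the hedgehog: [psi y] is the distance from [y] to the centre
    along the spine [pi y].  Half of it, to stay below one. *)
Definition hedgehog (z : Y * Y) : R :=
  (if pi z.1 == pi z.2 then `|psi z.1 - psi z.2| else psi z.1 + psi z.2) / 2.

Lemma hedgehog01 z : 0 <= hedgehog z <= 1.
Proof.
have := psi01 z.1; have := psi01 z.2; rewrite /hedgehog; case: ifP => _; last by lra.
move=> /andP[a1 a2] /andP[b1 b2]; apply/andP.
by case: (ger0P (psi z.1 - psi z.2)) => ?; split; lra.
Qed.

Lemma hedgehog_pseudometric : is_pseudometric hedgehog.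
Proof.
split=> [x y|x|x y|x y z]; rewrite ?/hedgehog /=.
- by have /andP[] := hedgehog01 (x, y).
- by rewrite eqxx subrr normr0 mul0r.
- by rewrite (eq_sym (pi y)) distrC (addrC (psi y) (psi x)).
- rewrite -mulrDl ler_pM2r ?invr_gt0 //.
  have := psi01 x; have := psi01 y; have := psi01 z.
  have := ler_distD (psi y) (psi x) (psi z).
  move=> tri /andP[z0 z1] /andP[y0 y1] /andP[x0 x1].
  have [->|xy] := eqVneq (pi x) (pi y); have [eyz|yz] := eqVneq (pi y) (pi z).
  + by [].
  + by case: (ger0P (psi x - psi y)); lra.
  + by rewrite -eyz (negbTE xy); case: (ger0P (psi y - psi z)); lra.
  + by case: eqVneq => _; case: (ger0P (psi x - psi z)); lra.
Qed.

Lemma hedgehog_continuous : continuous psi ->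
    (forall y, \forall z \near y, psi z = 0 \/ pi z = pi y) ->
  continuous hedgehog.
Proof.
move=> cpsi pic [x y].
apply: (@cvg_le_dist _ _ _ _ _
    (fun z => `|psi z.1 - psi x| + `|psi z.2 - psi y|)); last first.
  have c1 : psi z.1 - psi x @[z --> (x, y)] --> (0 : R).
    rewrite -(subrr (psi x)); apply: (@cvgB _ R^o); last exact: cvg_cst.
    by apply: (@cvg_comp _ _ _ _ psi); [exact: cvg_fst|exact: cpsi].
  have c2 : psi z.2 - psi y @[z --> (x, y)] --> (0 : R).
    rewrite -(subrr (psi y)); apply: (@cvgB _ R^o); last exact: cvg_cst.
    by apply: (@cvg_comp _ _ _ _ psi); [exact: cvg_snd|exact: cpsi].
  have -> : (0 : R) = `|0 : R| + `|0 : R| by rewrite normr0 addr0.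
  by apply: (@cvgD _ R^o); apply: (@cvg_norm _ R^o).
have H1 : \forall z \near (x, y), psi z.1 = 0 \/ pi z.1 = pi x.
  exact: (@cvg_fst _ _ (nbhs x) (nbhs y) _ _ (pic x)).
have H2 : \forall z \near (x, y), psi z.2 = 0 \/ pi z.2 = pi y.
  exact: (@cvg_snd _ _ (nbhs x) (nbhs y) _ _ (pic y)).
apply: filterS2 H1 H2 => -[x' y'] /= H1 H2.
rewrite /hedgehog /= -mulrBl normrM (gtr0_norm (x := 2^-1)) ?invr_gt0 //.
rewrite ler_pdivrMr //.
have /andP[x0 _] := psi01 x; have /andP[y0 _] := psi01 y.
have /andP[x'0 _] := psi01 x'; have /andP[y'0 _] := psi01 y'.
have D1 := ler_norm (psi x' - psi x); have D1' := ler_norm (- (psi x' - psi x)).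
have D2 := ler_norm (psi y' - psi y); have D2' := ler_norm (- (psi y' - psi y)).
rewrite !normrN in D1' D2'.
have bound b : `|(if b then `|psi x' - psi y'| else psi x' + psi y') -
    (if b then `|psi x - psi y| else psi x + psi y)| <=
    (`|psi x' - psi x| + `|psi y' - psi y|) * 2.
  rewrite ler_norml; apply/andP; case: b; last by split; lra.
  by case: (ger0P (psi x' - psi y')) => ?; case: (ger0P (psi x - psi y)) => ?; split; lra.
case: H1 => [e1|->].
  have E c : (if c then `|psi x' - psi y'| else psi x' + psi y') = psi y'.
    by case: c; rewrite e1 add0r ?normrN ?ger0_norm.
  by move: (bound (pi x == pi y)); rewrite !E.
case: H2 => [e2|->] //.
have E c : (if c then `|psi x' - psi y'| else psi x' + psi y') = psi x'.
  by case: c; rewrite e2 ?subr0 ?addr0 ?ger0_norm.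
by move: (bound (pi x == pi y)); rewrite !E.
Qed.

End hedgehog.

(** * A continuous metric on a stratifiable space *)

Lemma wsup_pseudometric (R : realType) (Z : Type) (h : nat -> Z * Z -> R) :
    (forall k z, 0 <= h k z <= 1) -> (forall k, is_pseudometric (h k)) ->
  is_pseudometric (wsup h).
Proof.
move=> h01 hp; split=> [x y|x|x y|x y z].
- by have /andP[] := wsup01 h01 (x, y).
- have /andP[w0 _] := wsup01 h01 (x, x).
  apply/eqP; rewrite eq_le w0 andbT; apply: wsup_le => // k.
  by have [_ -> _ _] := hp k; rewrite mul0r.
- have le u v : wsup h (u, v) <= wsup h (v, u).
    by apply: wsup_le => // k; have [_ _ -> _] := hp k; exact: ge_wsup.
  by apply/eqP; rewrite eq_le !le.
- apply: wsup_le => // k; have [_ _ _ tri] := hp k.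
  apply: (@le_trans _ _ (h k (x, y) / k.+1%:R + h k (y, z) / k.+1%:R)).
    by rewrite -mulrDl ler_pM2r ?invr_gt0.
  by rewrite lerD // ge_wsup.
Qed.

Lemma pseudometric_dist (R : realType) (Z : Type) (d : Z * Z -> R) x y x' y' :
  is_pseudometric d -> `|d (x', y') - d (x, y)| <= d (x, x') + d (y, y').
Proof.
move=> [_ _ ds dt]; rewrite ler_norml; apply/andP; split.
  have := dt x x' y; have := dt x' y' y; rewrite (ds y' y); lra.
have := dt x' x y'; have := dt x y y'; rewrite (ds x' x); lra.
Qed.

Section stratified_metric.
Context {R : realType} {Y : topologicalType}.
Variable S : set Y -> nat -> set Y.
Hypothesis T1 : accessible_space Y.
Hypothesis SS : stratification S.

Lemma stratified_separated (x y : Y) : x <> y -> exists U V : set Y,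
  [/\ open U, open V, U x, V y & U `&` V = set0].
Proof.
move=> xy; have cl := accessible_closed_set1 T1.
have [|U [V [oU oV xU yV UV]]] := (@normal_openP R Y).1
  (stratified_normal SS R) _ _ (cl x) (cl y).
  by rewrite -subset0 => z [/= -> /xy].
by exists U, V; split=> //; [exact: xU|exact: yV].
Qed.

(** For distinct [x] and [y] there is [n] such that no neighbourhood
    [shadow S n w] contains both, for [w] would lie in two disjoint open sets.
    Hence a function subordinate to the cover by these neighbourhoods that is
    positive at [x] separates [x] from [y] in its hedgehog. *)
Lemma stratified_metric (y0 : Y) : exists d : Y * Y -> R,
  [/\ is_metric d, continuous d & forall z, d z <= 1].
Proof.
have /choice[psi /choice[pi P]] n : exists psi, exists pi, _ :=
  partition_functions (R := R) SS y0 (shadow_open S n).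
pose h n k := hedgehog (psi n k) (pi n k).
have h01 n k z : 0 <= h n k z <= 1.
  by apply: hedgehog01 => y; have [_ H _ _ _] := P n; exact: H.
have H01 n z : 0 <= wsup (h n) z <= 1 by apply: wsup01.
exists (wsup (fun n => wsup (h n))); split; last 2 first.
- apply: wsup_continuous => // n; apply: wsup_continuous => // k.
  have [c01 H1 _ H2 _] := P n.
  apply: hedgehog_continuous; [exact: H1|exact: c01|exact: H2].
- by move=> z; have /andP[] := wsup01 H01 z.
have pm : is_pseudometric (wsup (fun n => wsup (h n))).
  apply: wsup_pseudometric => // n; apply: wsup_pseudometric => // k.
  by apply: hedgehog_pseudometric => y; have [_ H _ _ _] := P n; exact: H.
split=> // x y d0; apply: contrapT => xy.
have [U [V [oU oV Ux Vy UV0]]] := stratified_separated xy.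
have [k1 Sx] := stratum SS oU Ux; have [k2 Sy] := stratum SS oV Vy.
pose n := maxn k1 k2.
have [_ psi01 psiU _ /(_ x) [|k psik]] := P n.
  by exists x; exact: shadow_center.
suff : 0 < wsup (fun n => wsup (h n)) (x, y) by rewrite d0 ltxx.
apply/wsup_gt0 => //; exists n; apply/wsup_gt0 => //; exists k.
rewrite /h /hedgehog /= divr_gt0 //.
have := psi01 k y; case: eqVneq => [e|_ /andP[y0' _]]; last by rewrite ltr_wpDr.
move=> _; rewrite normr_gt0 subr_eq0; apply/negP => /eqP exy.
have w1 := psiU _ _ psik.
have w2 : shadow S n (pi n k x) y by rewrite e; apply: psiU; rewrite -exy.
have : (U `&` V) (pi n k x).
  by split; [apply: shadowP Sx _ w1 | apply: shadowP Sy _ w2]; rewrite // ?leq_maxl ?leq_maxr.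
by rewrite UV0.
Qed.

End stratified_metric.

(** * Covers of the complement of a closed set *)

Section dugundji_cover.
Context {Y : topologicalType}.
Variable S : set Y -> nat -> set Y.
Hypothesis T1 : accessible_space Y.
Hypothesis SS : stratification S.

(** The set attached to [w] outside [X] is a stratum of the complement of [X]
    cut down to the shadow of [w], and [a w] is a point of [X] such that [w]
    belongs to [shadow S m (a w)] with [m] as large as possible.  The stratum
    that contains [w] bounds [m].  If [y] is close to [x] and lies in the set
    attached to [w], then [w] is close to [x], hence belongs to [shadow S k x]
    for a large [k]; thus [k <= m], and [a w] is close to [x] too. *)
Lemma dugundji_cover (X : set Y) (x0 : X) : closed X ->
  exists (U : Y -> set Y) (a : Y -> X),
  [/\ forall w, open (U w), forall y, (exists w, U w y) <-> ~ X y &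
      forall (x : X) (O : set Y), open O -> O (\val x) ->
        \forall y \near \val x, forall w, U w y -> O (\val (a w))].
Proof.
move=> cX; have oW : open (~` X) by exact: closed_openC.
have /choice[n nP] : forall w, exists n, ~ X w -> S (~` X) n w.
  move=> w; have [Xw|Xw] := pselect (X w); first by exists 0%N.
  by have [n Sn] := stratum SS oW Xw; exists n.
pose U w := [set y | ~ X w /\ (S (~` X) (n w) y /\ shadow S (n w) w y)].
have bnd w (x : X) k : ~ X w -> shadow S k (\val x) w -> (k < n w)%N.
  move=> Xw kx; rewrite ltnNge; apply/negP => nk.
  by apply: (shadowP T1 SS oW (nP w Xw) nk kx); exact: set_valP.
have /choice[a aP] : forall w, exists a : X, forall k (x : X), ~ X w ->
    shadow S k (\val x) w -> exists2 m, (k <= m)%N & shadow S m (\val a) w.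
  move=> w; have [ex|nex] :=
    pselect (exists k, `[< ~ X w /\ exists x : X, shadow S k (\val x) w >]).
    have ub k : `[< ~ X w /\ exists x : X, shadow S k (\val x) w >] -> (k <= n w)%N.
      by move=> /asboolP[Xw [x kx]]; exact: ltnW (bnd w x k Xw kx).
    case: (ex_maxnP ex ub) => m /asboolP[_ [a ma]] mm; exists a => k x Xw kx.
    by exists m => //; apply: mm; apply/asboolP; split=> //; exists x.
  exists x0 => k x Xw kx; exfalso; apply: nex; exists k; apply/asboolP; split=> //.
  by exists x.
exists U, a; split.
- move=> w; have [Xw|Xw] := pselect (X w).
    rewrite (_ : U w = set0); first exact: open0.
    by rewrite -subset0 => y [].
  rewrite (_ : U w = S (~` X) (n w) `&` shadow S (n w) w); last first.
    by apply/seteqP; split=> y; [case|split].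
  by apply: openI; [have [H _ _] := SS; exact: (H _ oW _).1|exact: shadow_open].
- move=> y; split=> [[w [_ [Sy _]]]|Xy]; first exact: stratum_sub Sy.
  by exists y; split=> //; split; [exact: nP|exact: shadow_center].
- move=> x O oO Ox; have [k Sk] := stratum SS oO Ox.
  pose O' := S O k `&` shadow S k (\val x).
  have oO' : open O'.
    by apply: openI; [have [H _ _] := SS; exact: (H _ oO _).1|exact: shadow_open].
  have [k2 Sk2] : exists k2, S O' k2 (\val x).
    by apply: stratum => //; split=> //; exact: shadow_center.
  have := near_stratum SS oO' Sk2.
  have := open_near (shadow_open S k2 (\val x)) (shadow_center T1 SS k2 (\val x)).
  apply: filterS2 => y shy Sy w [Xw [Swy shw]].
  have [Skw shk] : O' w.
    have [k2n|/ltnW nk2] := leqP k2 (n w); first exact: shadowP Sy k2n shw.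
    by have := shadowP T1 SS oW Swy nk2 shy; have := set_valP x.
  have [m km ma] := aP w k x Xw shk.
  exact: shadowP Skw km ma.
Qed.

End dugundji_cover.

Section metric_cover.
Context {R : realType} {Y : topologicalType}.

Lemma metrizable_bounded : metrizable R Y -> exists d : Y * Y -> R,
  [/\ is_metric d, continuous d, forall z, d z <= 1 & dominating d].
Proof.
move=> [e [[pe ee] nbhsE]].
pose d z := Num.min 1 (e z).
have [e0 exx es et] := pe.
have pd : is_pseudometric d.
  split=> [x y|x|x y|x y z]; rewrite /d.
  - by rewrite le_min ler01 e0.
  - by rewrite exx min_r.
  - by rewrite es.
  - have := et x y z; have := e0 x y; have := e0 y z.
    by case: (leP 1 (e (x, z))) => ?; case: (leP 1 (e (x, y))) => ?;
      case: (leP 1 (e (y, z))) => ?; lra.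
have dz z : d z <= 1 by rewrite ge_min lexx.
exists d; split=> //.
- split=> // x y; rewrite /d => dxy; apply: ee.
  by move: dxy; case: (leP 1 (e (x, y))) => //; lra.
- move=> [x y].
  have near0 u : \forall v \near u, d (u, v) <= e (u, v).
    by apply: nearW => v; rewrite /d ge_min lexx orbT.
  have cv u : e (u, v) @[v --> u] --> (0 : R).
    apply/cvgrPdist_lt => r r0; have : nbhs u [set v | e (u, v) < r].
      by rewrite nbhsE; exists r.
    by apply: filterS => v /= H; rewrite sub0r normrN ger0_norm.
  apply: (@cvg_le_dist _ _ _ _ _ (fun z => e (x, z.1) + e (y, z.2))); last first.
    rewrite -(addr0 (0 : R)); apply: (@cvgD _ R^o).
      by apply: (@cvg_comp _ _ _ fst (fun v => e (x, v)) _ _ _ cvg_fst); exact: cv.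
    by apply: (@cvg_comp _ _ _ snd (fun v => e (y, v)) _ _ _ cvg_snd); exact: cv.
  apply: nearW => -[x' y'] /=; apply: le_trans (pseudometric_dist _ _ _ _ pd) _.
  by rewrite lerD // /d ge_min lexx orbT.
- move=> x O; rewrite nbhsE => -[r /= r0 H].
  exists (Num.min r 1); first by rewrite /= lt_min r0 ltr01.
  move=> y /=; rewrite lt_min => /andP[H1 H2]; apply: H => /=.
  by move: H1 H2; rewrite /d; case: (leP 1 (e (x, y))) => //; lra.
Qed.

Variables (d : Y * Y -> R) (X : set Y).
Hypotheses (dm : is_metric d) (dc : continuous d) (d1 : forall z, d z <= 1).
Hypothesis d_dom : dominating d.
Variable x0 : X.

Let dp : is_pseudometric d. Proof. by case: dm. Qed.

Definition set_dist y : R := inf (range (fun x : X => d (y, \val x))).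

Lemma set_dist_has_inf y : has_inf (range (fun x : X => d (y, \val x))).
Proof.
split; first by exists (d (y, \val x0)), x0.
by exists 0 => _ [x _ <-]; have [-> _ _ _] := dp.
Qed.

Lemma set_dist_le y (x : X) : set_dist y <= d (y, \val x).
Proof. by apply: (ge_inf (set_dist_has_inf y).2); exists x. Qed.

Lemma set_dist_ge y c : (forall x : X, c <= d (y, \val x)) -> c <= set_dist y.
Proof. by move=> H; apply: (lb_le_inf (set_dist_has_inf y).1) => _ [x _ <-]. Qed.

Lemma set_dist01 y : 0 <= set_dist y <= 1.
Proof.
rewrite (le_trans (set_dist_le y x0)) // andbT; apply: set_dist_ge => x.
by have [-> _ _ _] := dp.
Qed.

Lemma set_dist_lip y z : set_dist y <= set_dist z + d (y, z).
Proof.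
rewrite -lerBlDr; apply: set_dist_ge => x; rewrite lerBlDr.
apply: le_trans (set_dist_le y x) _; have [_ _ _ dt] := dp.
by rewrite addrC; exact: dt.
Qed.

Lemma dist_continuousl w : continuous (fun y => d (y, w)).
Proof.
move=> y; apply: (@continuous_comp _ _ _ (fun y => (y, w)) d); last exact: dc.
by apply: cvg_pair => /=; [exact: cvg_id|exact: cvg_cst].
Qed.

Lemma set_dist_continuous : continuous set_dist.
Proof.
move=> y; apply: (@cvg_le_dist _ _ _ _ _ (fun z => d (z, y))); last first.
  by have [_ /(_ y) <- _ _] := dp; exact: (@dist_continuousl y y).
apply: nearW => z; rewrite ler_norml.
have := set_dist_lip y z; have := set_dist_lip z y; have [_ _ ds _] := dp.
by rewrite (ds y z); lra.
Qed.

Lemma set_dist_in y : X y -> set_dist y = 0.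
Proof.
move=> Xy; have /andP[s0 _] := set_dist01 y; apply/eqP; rewrite eq_le s0 andbT.
have [_ dxx _ _] := dp.
by have := set_dist_le y (SigSub (mem_set Xy)); rewrite /= dxx.
Qed.

Lemma set_dist_gt0 y : closed X -> ~ X y -> 0 < set_dist y.
Proof.
move=> cX Xy; have := d_dom (open_near (closed_openC cX) Xy).
move=> [r /= r0 H]; apply: lt_le_trans r0 _; apply: set_dist_ge => x.
by rewrite leNgt; apply/negP => /H; apply; exact: set_valP.
Qed.

(** The constants: [w] is at distance at most a quarter of its distance to [X]
    from [y], and [a w] at distance at most twice that distance from [w]. *)
Lemma metric_cover : closed X -> exists (U : Y -> set Y) (a : Y -> X),
  [/\ forall w, open (U w), forall y, (exists w, U w y) <-> ~ X y &
      forall y w, U w y -> d (y, \val (a w)) <= 3 * set_dist y].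
Proof.
move=> cX; have [_ dxx ds dt] := dp.
have /choice[a aP] : forall w, exists a : X, ~ X w -> d (w, \val a) < 2 * set_dist w.
  move=> w; have [Xw|Xw] := pselect (X w); first by exists x0.
  have [|_ [x _ <-] H] := inf_adherent _ (set_dist_has_inf w) (eps := set_dist w).
    exact: set_dist_gt0.
  by exists x => _; rewrite mulr_natl mulr2n.
exists (fun w => [set y | 4 * d (y, w) < set_dist w]), a; split.
- move=> w; apply/open_nearP => y H.
  have c : 4 * d (z, w) @[z --> y] --> 4 * d (y, w).
    by apply: (@cvgM R); [exact: cvg_cst|exact: dist_continuousl].
  exact: cvgr_lt c _ H.
- move=> y; split=> [[w H] Xy|Xy].
    have := set_dist_lip w y; rewrite (set_dist_in Xy) add0r (ds w y).
    have [d0 _ _ _] := dp; have := d0 y w; move: H => /=; lra.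
  by exists y; rewrite /= dxx mulr0 set_dist_gt0.
- move=> y w /= H.
  have Xw : ~ X w.
    by move=> /set_dist_in e; move: H; rewrite e; have [d0 _ _ _] := dp; have := d0 y w; lra.
  have := aP w Xw; have := dt y w (\val (a w)); have := set_dist_lip w y.
  by rewrite (ds w y); lra.
Qed.

End metric_cover.

(** * The random retraction *)

(** The random retraction takes the value [node n y] on the interval between
    [tau n.+1 y] and [tau n.+2 y]; the first interval, of length [tau 1 y], is
    that of the symbol of [y].  The nodes matter only where their interval is
    not empty. *)
Record dugundji_system (R : realType) (Y : topologicalType) (X : set Y)
    (tau : nat -> Y -> R) (node : nat -> Y -> X) : Prop := DugundjiSystem {
  dg_subdivision : forall y, subdivision (tau^~ y);
  dg_weight_continuous : continuous (tau 1%N);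
  dg_weight_in : forall y, X y -> tau 1%N y = 0;
  dg_weight_out : forall y, ~ X y -> 0 < tau 1%N y;
  dg_node_in : forall n (x : X), node n (\val x) = x;
  dg_continuous : forall n y, ~ X y -> {for y, continuous (tau n)};
  dg_finite : forall y, ~ X y -> exists N, \forall z \near y, tau N z = 1;
  dg_node_const : forall n y, ~ X y -> \forall z \near y,
    tau n.+2 z = tau n.+1 z \/ node n z = node n y;
  dg_node_near : forall (x : X) (O : set X), nbhs x O -> \forall y \near \val x,
    forall n, tau n.+1 y < tau n.+2 y -> O (node n y) }.

(** The thresholds are the partial sums of the functions subordinate to the
    cover, divided by their supremum and truncated at one.  The supremum
    is weighted, so it is less than twice a single term; with the factor three
    the truncation is effective after finitely many terms, near each point. *)
Section construction.
Context {R : realType} {Y : topologicalType}.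
Variable S : set Y -> nat -> set Y.
Hypothesis SS : stratification S.
Variables (X : set Y) (lam : Y -> R) (U : Y -> set Y) (a : Y -> X) (y0 : Y).
Hypotheses (cX : closed X) (clam : continuous lam) (lam1 : forall y, lam y <= 1).
Hypotheses (lam_in : forall y, X y -> lam y = 0) (lam_out : forall y, ~ X y -> 0 < lam y).
Hypotheses (oU : forall w, open (U w)) (UX : forall y, (exists w, U w y) <-> ~ X y).
Hypothesis Ua : forall (x : X) (O : set Y), open O -> O (\val x) ->
  \forall y \near \val x, forall w, U w y -> O (\val (a w)).

Lemma dugundji_systemP : exists (tau : nat -> Y -> R) (node : nat -> Y -> X),
  [/\ dugundji_system tau node, tau 1%N = lam &
      forall y n, ~ X y -> tau n.+1 y < tau n.+2 y -> exists w, U w y /\ node n y = a w].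
Proof.
have [psi [pi [cpsi psi01 psiU pi_const psi_gt0]]] := partition_functions (R := R) SS y0 oU.
have cmu := wsup_continuous psi01 cpsi; set mu := wsup psi in cmu.
have oW : open (~` X) by exact: closed_openC.
have mu_gt0 y : ~ X y -> 0 < mu y.
  by move=> Xy; apply/wsup_gt0 => //; apply: psi_gt0; apply/UX.
pose s n y := Num.min 1 (\sum_(i < n) 3 * psi i y / mu y).
pose node n y := match pselect (X y) with
  | left Xy => SigSub (mem_set Xy) | right _ => a (pi n y) end.
pose tau n y := if n is m.+1 then
  if `[< X y >] then (0 < m)%N%:R else lam y + (1 - lam y) * s m y else 0.
have tau_in n y : X y -> tau n.+1 y = (0 < n)%N%:R by move=> Xy; rewrite /tau asboolT.
have tau_out n y : ~ X y -> tau n.+1 y = lam y + (1 - lam y) * s n y.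
  by move=> Xy; rewrite /tau asboolF.
have node_out n y : ~ X y -> node n y = a (pi n y) by rewrite /node; case: pselect.
have node_in n (x : X) : node n (\val x) = x.
  rewrite /node; case: pselect => [Xx|]; first exact/val_inj.
  by have := set_valP x.
have term_ge0 i y : ~ X y -> 0 <= 3 * psi i y / mu y.
  move=> Xy; have /andP[p0 _] := psi01 i y.
  by rewrite divr_ge0 ?mulr_ge0 // ltW // mu_gt0.
have s0 y : s 0%N y = 0 by rewrite /s big_ord0 min_r.
have s_incr n y : ~ X y -> s n y <= s n.+1 y.
  move=> Xy; rewrite /s big_ord_recr /=; have := term_ge0 n y Xy.
  set u := \sum_(i < n) _; set v := 3 * _ / _ => v0.
  by case: (leP 1 u) => ?; case: (leP 1 (u + v)) => ?; lra.
have s_le1 n y : s n y <= 1 by rewrite ge_min lexx.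
have s_psi n y : ~ X y -> s n y < s n.+1 y -> 0 < psi n y.
  move=> Xy; rewrite /s big_ord_recr /= lt_neqAle eq_sym => /andP[+ _].
  apply: contra_neqT; rewrite -leNgt => p0.
  have /andP[p1 _] := psi01 n y; have -> : psi n y = 0 by apply/eqP; rewrite eq_le p0.
  by rewrite mulr0 mul0r addr0.
have active n y : ~ X y -> tau n.+1 y < tau n.+2 y -> 0 < psi n y.
  move=> Xy; rewrite !tau_out // => H; apply: s_psi => //.
  move: H; rewrite ltrD2l; have := lam1 y; rewrite le_eqVlt => /predU1P[->|l1].
    by rewrite subrr !mul0r ltxx.
  by rewrite ltr_pM2l // subr_gt0.
have finite y : ~ X y -> exists N, \forall z \near y, tau N z = 1.
  move=> Xy; have m0 := mu_gt0 y Xy.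
  have [|i Hi] := @wsup_gt _ _ _ psi01 y (mu y / 2).
    by rewrite -/(mu y) ltr_pdivrMr // mulr_natr mulr2n ltrDl.
  have Hi' : 0 < 3 * psi i y - mu y.
    have /andP[p0 _] := psi01 i y.
    have Hi' : psi i y / i.+1%:R <= psi i y by rewrite ler_pdivrMr // ler_peMr // ler1n.
    have := lt_le_trans Hi Hi'; lra.
  have c : 3 * psi i z - mu z @[z --> y] --> 3 * psi i y - mu y.
    by apply: (@cvgB _ R^o); [apply: (@cvgM R); [exact: cvg_cst|exact: cpsi]|exact: cmu].
  have pos : \forall z \near y, 0 < 3 * psi i z - mu z by exact: cvgr_gt c _ Hi'.
  exists i.+2; apply: filterS2 pos (open_near oW Xy) => z Hz Xz.
  rewrite tau_out // (_ : s _ _ = 1); first by ring.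
  rewrite /s min_l // big_ord_recr /=; have mz := mu_gt0 z Xz.
  have : 1 <= 3 * psi i z / mu z by rewrite ler_pdivlMr // mul1r; lra.
  have : 0 <= \sum_(j < i) 3 * psi j z / mu z by apply: sumr_ge0 => j _; exact: term_ge0.
  lra.
have subdiv y : subdivision (tau^~ y).
  have [Xy|Xy] := pselect (X y).
    split=> //; last by exists 2%N; rewrite tau_in.
      by case=> [|[|n]]; rewrite ?tau_in //= ?ler01.
    by case=> [|[|n]]; rewrite ?tau_in //= ?ler01.
  have l0 := lam_out Xy; have l1 := lam1 y.
  split=> //.
  - case=> [|n]; first by rewrite tau_out // s0 mulr0 addr0 ltW.
    by rewrite !tau_out // lerD2l ler_wpM2l ?subr_ge0 // s_incr.
  - case=> [|n]; first by rewrite ler01.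
    have : (1 - lam y) * s n y <= 1 - lam y by rewrite ler_piMr ?subr_ge0.
    by rewrite tau_out //; lra.
  - by have [N /nbhs_singleton] := finite y Xy; exists N.
exists tau, node; split; last first.
- move=> y n Xy Hn; exists (pi n y); split; last exact: node_out.
  by apply: psiU; exact: active.
- apply/funext => y; have [Xy|Xy] := pselect (X y); first by rewrite tau_in // lam_in.
  by rewrite tau_out // s0 mulr0 addr0.
have tau1 : tau 1%N = lam.
  apply/funext => y; have [Xy|Xy] := pselect (X y); first by rewrite tau_in // lam_in.
  by rewrite tau_out // s0 mulr0 addr0.
split=> //.
- by rewrite tau1.
- by move=> y Xy; rewrite tau1 lam_in.
- by move=> y Xy; rewrite tau1 lam_out.
- case=> [|n] y Xy; first exact: cvg_cst.
  rewrite /prop_for /continuous_at tau_out //.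
  have near_tau : {near y, (fun z => lam z + (1 - lam z) * s n z) =1 tau n.+1}.
    by apply: filterS (open_near oW Xy) => z Xz; rewrite tau_out.
  apply: cvg_trans (near_eq_cvg near_tau) _.
  apply: (@cvgD _ R^o); first exact: clam.
  apply: (@cvgM R); first by apply: (@cvgB _ R^o); [exact: cvg_cst|exact: clam].
  apply: cvg_minr; first exact: cvg_cst.
  apply: cvg_sum_seq => i; apply: (@cvgM R).
    by apply: (@cvgM R); [exact: cvg_cst|exact: cpsi].
  by apply: cvgV; [rewrite gt_eqF // mu_gt0|exact: cmu].
- move=> n y Xy; apply: filterS2 (pi_const n y) (open_near oW Xy) => z [p0|pz] Xz.
    by left; rewrite !tau_out // /s big_ord_recr /= p0 mulr0 mul0r addr0.
  by right; rewrite !node_out // pz.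
- move=> x O /open_of_near_set_type[V [oV Vx VO]].
  apply: filterS2 (Ua oV Vx) (open_near oV Vx) => y Hy Vy n Hn.
  apply: VO; have [Xy|Xy] := pselect (X y).
    by have := node_in n (SigSub (mem_set Xy)) => /= ->.
  by rewrite node_out //; apply: Hy; apply: psiU; exact: active.
Qed.

End construction.

(** * The extension operator of the random retraction *)

Section extension.
Context {R : realType} {Y : topologicalType} {X : set Y}.
Variables (d : Y * Y -> R) (tau : nat -> Y -> R) (node : nat -> Y -> X) (a b : X).
Hypotheses (dm : is_metric d) (d1 : forall z, d z <= 1) (ab : a <> b).
Hypothesis dg : dugundji_system tau node.
Implicit Types (p q : X * X -> R) (y : Y).

(** The extension of [p] to the disjoint union of [X] and of the symbols.  The
    formulas are symmetric in [a] and [b], so that they are defined, linear and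
    positive for all functions [p], and not only for pseudometrics. *)
Definition cone_ext p (z z' : X + Y) : R :=
  match z, z' with
  | inl x, inl x' => p (x, x')
  | inl x, inr _ => (p (x, a) + p (x, b)) / 2
  | inr _, inl x' => (p (a, x') + p (b, x')) / 2
  | inr y, inr y' => ((1 - d (y, y')) * (p (a, a) + p (b, b)) +
                      d (y, y') * (p (a, b) + p (b, a))) / 2
  end.

Definition point n y : X + Y := if n is m.+1 then inl (node m y) else inr y.

Definition pair_ext p (z : Y * Y) : R :=
  pairing (tau^~ z.1) (tau^~ z.2) (fun n m => cone_ext p (point n z.1) (point m z.2)).

(** The points of [X] on which the extension of [p] depends at [y]. *)
Definition values y : set X :=
  [set x | [\/ x = a, x = b | exists2 n, tau n.+1 y < tau n.+2 y & x = node n y]].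

Let subd y : subdivision (tau^~ y). Proof. exact: (dg_subdivision dg). Qed.
Hint Resolve subd : core.

Let d0 z : 0 <= d z. Proof. by case: z => y y'; case: dm => -[]. Qed.

Lemma cone_ext_linear c p q z z' :
  cone_ext (fun t => c * p t + q t) z z' = c * cone_ext p z z' + cone_ext q z z'.
Proof. by case: z z' => [x|y] [x'|y'] /=; field. Qed.

Lemma pair_ext_linear c p q z :
  pair_ext (fun t => c * p t + q t) z = c * pair_ext p z + pair_ext q z.
Proof.
rewrite /pair_ext -pairingZ -pairingD; apply: eq_pairing => n m _.
exact: cone_ext_linear.
Qed.

Definition support (z : X + Y) : set X :=
  if z is inl x then [set x] else [set x | x = a \/ x = b].

Lemma cone_ext_bound p z z' c e :
    (forall x x', support z x -> support z' x' -> c <= p (x, x') <= e) ->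
  c <= cone_ext p z z' <= e.
Proof.
have ra : support (inr _) a by move=> t; left.
have rb : support (inr _) b by move=> t; right.
case: z z' => [x|y] [x'|y'] H /=.
- exact: H.
- by have := H x a erefl (ra y'); have := H x b erefl (rb y'); lra.
- by have := H a x' (ra y) erefl; have := H b x' (rb y) erefl; lra.
- have := H _ _ (ra y) (ra y'); have := H _ _ (rb y) (rb y').
  have := H _ _ (ra y) (rb y'); have := H _ _ (rb y) (ra y').
  set u := p (a, a) + p (b, b); set v := p (a, b) + p (b, a) => ba ab' bb aa.
  have : c + c <= u <= e + e by rewrite /u; lra.
  have : c + c <= v <= e + e by rewrite /v; lra.
  have := d0 (y, y'); have := d1 (y, y').
  move: (d (y, y')) u v => t u v {H ba ab' bb aa} t1 t0 /andP[v1 v2] /andP[u1 u2].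
  by rewrite ler_pdivlMr // ler_pdivrMr //; apply/andP; split; nra.
Qed.

Lemma support_values n y : tau n y < tau n.+1 y -> support (point n y) `<=` values y.
Proof.
case: n => [|n] act x /=; last by move=> ->; apply: Or33; exists n.
by case=> ->; [exact: Or31|exact: Or32].
Qed.

Lemma pair_ext_bound p y y' c e :
    (forall x x', values y x -> values y' x' -> c <= p (x, x') <= e) ->
  c <= pair_ext p (y, y') <= e.
Proof.
move=> H; rewrite -[X in X <= _](pairing_cst c (subd y) (subd y')).
rewrite -[X in _ && (_ <= X)](pairing_cst e (subd y) (subd y')).
have bd n m : 0 < overlap (tau^~ y) (tau^~ y') n m ->
    c <= cone_ext p (point n y) (point m y') <= e.
  move=> /(overlap_gt0 (subd y) (subd y'))[nact mact]; apply: cone_ext_bound => x x' xs x's.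
  by apply: H; [exact: support_values xs|exact: support_values x's].
by apply/andP; split; apply: ler_pairing => // n m /bd/andP[].
Qed.

Lemma pair_ext_ge0 p z : (forall t, 0 <= p t) -> 0 <= pair_ext p z.
Proof.
move=> p0; rewrite -(pairing_cst 0 (subd z.1) (subd z.2)).
apply: ler_pairing => // n m _; case: (point n z.1) (point m z.2) => [x|y] [x'|y'] //=.
- by rewrite divr_ge0 ?addr_ge0.
- by rewrite divr_ge0 ?addr_ge0.
- by apply: divr_ge0 => //; apply: addr_ge0; apply: mulr_ge0; rewrite ?subr_ge0 ?d0 ?d1 ?addr_ge0.
Qed.

(** Over [X] there is no symbol: its interval is empty. *)
Lemma point_in n (x : X) : 0 < tau n.+1 (\val x) - tau n (\val x) -> point n (\val x) = inl x.
Proof.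
case: n => [|n] /=; last by rewrite (dg_node_in dg).
have [t0 _ _ _] := subd (\val x).
by rewrite (dg_weight_in dg) ?t0 ?subrr ?ltxx //; exact: set_valP.
Qed.

Lemma pair_ext_extends p (x x' : X) : pair_ext p (\val x, \val x') = p (x, x').
Proof.
rewrite -[RHS](pairing_cst _ (subd (\val x)) (subd (\val x'))).
apply: eq_pairing => n m /eqP; rewrite neq_lt ltNge overlap_ge0 //=.
move=> /(overlap_gt0 (subd _) (subd _))[nact mact].
by rewrite !point_in ?subr_gt0.
Qed.

Lemma cone_ext_pseudometric p : is_pseudometric p ->
  is_pseudometric (fun zz => cone_ext p zz.1 zz.2).
Proof.
move=> [p0 pxx ps pt]; have [dp _] := dm; have [_ dxx ds dt] := dp.
have pab := p0 a b.
split.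
- move=> [x|y] [x'|y'] /=; rewrite ?p0 //.
  + by have := p0 x a; have := p0 x b; lra.
  + by have := p0 a x'; have := p0 b x'; lra.
  + rewrite !pxx addr0 mulr0 add0r divr_ge0 // mulr_ge0 //.
    by have := p0 b a; lra.
- by move=> [x|y] /=; rewrite ?pxx ?dxx //; field.
- move=> [x|y] [x'|y'] /=; first exact: ps.
  + by rewrite (ps a) (ps b).
  + by rewrite (ps a) (ps b).
  + by rewrite (ds y).
- have dpab u v : 0 <= d (u, v) * (p (a, b) + p (a, b)) by rewrite mulr_ge0 ?addr_ge0.
  move=> [x|y] [x'|y'] [x''|y''] /=; rewrite ?pxx ?(ps b a).
  + exact: pt.
  + by have := pt x x' a; have := pt x x' b; lra.
  + by have := pt x a x''; have := pt x b x''; lra.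
  + by have := dpab y' y''; lra.
  + have := pt x'' x' a; have := pt x'' x' b.
    by rewrite (ps x'' x') (ps x'' a) (ps x'' b) (ps x' a) (ps x' b); lra.
  + have : d (y, y'') * (p (a, b) + p (a, b)) <= p (a, b) + p (a, b).
      by rewrite ler_piMl ?addr_ge0.
    by have := pt a x' b; rewrite (ps b x'); have := ps a x'; lra.
  + by have := dpab y y'; lra.
  + have : d (y, y'') * (p (a, b) + p (a, b)) <= (d (y, y') + d (y', y'')) * (p (a, b) + p (a, b)).
      by rewrite ler_wpM2r ?addr_ge0.
    lra.
Qed.

Lemma pair_ext_pseudometric p : is_pseudometric p -> is_pseudometric (pair_ext p).
Proof.
move=> pp; have [E0 Exx Es Et] := cone_ext_pseudometric pp.
split.
- move=> y y'; have [p0 _ _ _] := pp.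
  rewrite -(pairing_cst 0 (subd y) (subd y')).
  by apply: ler_pairing => // n m _; exact: (E0 _ _).
- move=> y; rewrite -[RHS](pairing_cst 0 (subd y) (subd y)).
  apply: eq_pairing => n m; have [<- _|nm] := eqVneq n m; first exact: Exx.
  by rewrite overlap_diag //; exact/eqP.
- move=> y y'; rewrite /pair_ext pairingC; apply: eq_pairing => n m _; exact: Es.
- move=> y y' y''; apply: pairing_triangle => // n m k; exact: Et.
Qed.

Section of_metric.
Variable p : X * X -> R.
Hypothesis pm : is_metric p.

Let pp : is_pseudometric p. Proof. by case: pm. Qed.

Let E0 n m y y' : 0 <= cone_ext p (point n y) (point m y').
Proof. by have [H _ _ _] := cone_ext_pseudometric pp; exact: (H _ _). Qed.

Lemma base_gt0 : 0 < p (a, b).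
Proof.
have [p0 _ _ _] := pp; rewrite lt_neqAle p0 andbT eq_sym; apply/eqP.
by case: pm => _ pe /pe.
Qed.

Lemma base_le x : p (a, b) / 2 <= (p (x, a) + p (x, b)) / 2.
Proof.
by have [_ _ ps pt] := pp; have := pt a x b; rewrite (ps a x); lra.
Qed.

(** Where one of the two points is at its symbol and the other is not, the
    distance is at least half of [p (a, b)]. *)
Lemma pair_ext_weight y y' :
  (tau 1%N y - tau 1%N y') * (p (a, b) / 2) <= pair_ext p (y, y').
Proof.
have [p0 _ ps _] := pp; have pab := base_gt0.
rewrite mulrBl -(pairing_firstl _ (subd y) (subd y')).
rewrite -(pairing_firstr _ (subd y) (subd y')) -pairingB.
apply: ler_pairing => // n m _; have := E0 n m y y'.
case: n m => [|n] [|m] /=; last by rewrite subrr.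
- by rewrite subrr.
- by rewrite subr0 (ps a) (ps b) base_le.
- by rewrite sub0r; lra.
Qed.

Lemma pair_ext_symbols y y' :
  Num.min (tau 1%N y) (tau 1%N y') * (d (y, y') * p (a, b)) <= pair_ext p (y, y').
Proof.
have [p0 pxx ps _] := pp.
have := pairing_ge_term 0 0 (subd y) (subd y') (fun n m => E0 n m y y').
rewrite -/(pair_ext p (y, y')); apply: le_trans.
rewrite /overlap /= !pxx (ps b a).
have [-> _ _ _] := subd y; have [-> _ _ _] := subd y'.
rewrite (@min_r _ _ (tau _ _) 0) ?subdivision_ge0 ?(subdivision_ge0 _ (subd y)) //.
rewrite (@min_l _ _ 0) ?(subdivision_ge0 _ (subd y')) // minxx.
by rewrite le_eqVlt; apply/orP; left; apply/eqP; field.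
Qed.

Lemma pair_ext_metric : is_metric (pair_ext p).
Proof.
have pep := pair_ext_pseudometric pp; split => // y y' e0; apply: contrapT => yy'.
have [_ _ es _] := pep.
have pab := base_gt0.
have one_in u v : X u -> ~ X v -> 0 < pair_ext p (v, u).
  move=> Xu Xv; apply: lt_le_trans (pair_ext_weight v u).
  by rewrite (dg_weight_in dg Xu) subr0 mulr_gt0 ?(dg_weight_out dg Xv) // divr_gt0.
have [Xy|Xy] := pselect (X y); have [Xy'|Xy'] := pselect (X y').
- have := pair_ext_extends p (SigSub (mem_set Xy)) (SigSub (mem_set Xy')).
  rewrite /= e0 => /esym; case: pm => _ pe /pe.
  by move=> /(congr1 val).
- by have := one_in _ _ Xy Xy'; rewrite es e0 ltxx.
- by have := one_in _ _ Xy' Xy; rewrite e0 ltxx.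
- have := pair_ext_symbols y y'; rewrite e0 leNgt => /negP; apply.
  rewrite mulr_gt0 ?lt_min ?(dg_weight_out dg) // mulr_gt0 //.
  rewrite lt_neqAle d0 andbT eq_sym; apply/eqP => dy.
  by case: dm => _ /(_ _ _ dy).
Qed.

End of_metric.

End extension.

(** * Continuity of the extension *)

Section extension_topology.
Context {R : realType} {Y : topologicalType} {X : set Y}.
Variables (d : Y * Y -> R) (tau : nat -> Y -> R) (node : nat -> Y -> X) (a b : X).
Hypotheses (dm : is_metric d) (d1 : forall z, d z <= 1) (dc : continuous d).
Hypothesis dg : dugundji_system tau node.
Implicit Types (p q : X * X -> R) (y : Y).

Let subd y : subdivision (tau^~ y). Proof. exact: (dg_subdivision dg). Qed.
Hint Resolve subd : core.
Local Notation pair_ext := (pair_ext d tau node a b).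
Local Notation cone_ext := (cone_ext d a b).
Local Notation point := (point node).
Local Notation values := (values tau node a b).
Local Notation support := (support a b).

Lemma values_in (x : X) : values (\val x) x.
Proof.
have [N tN] : exists N, tau N (\val x) = 1 by have [_ _ _] := subd (\val x).
have [n] : exists n, tau n.+1 (\val x) < tau n.+2 (\val x).
  apply: contrapT => nact.
  have t0 n : tau n (\val x) = 0.
    elim: n => [|[|n] IHn]; first by have [] := subd (\val x).
      by rewrite (dg_weight_in dg) //; exact: set_valP.
    apply/eqP; rewrite eq_le -{2}IHn; have [_ -> _ _] := subd (\val x); rewrite andbT.
    by rewrite -IHn leNgt; apply/negP => H; apply: nact; exists n.
  by move: tN; rewrite t0 => /eqP; rewrite eq_sym oner_eq0.
by move=> act; apply: Or33; exists n => //; rewrite (dg_node_in dg).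
Qed.

Lemma finite_values y : finite_set (values y).
Proof.
have [_ _ _ [N tN]] := subd y.
apply: (@sub_finite_set _ _ ([set a; b] `|` (node^~ y) @` `I_N)); last first.
  by rewrite finite_setU; split; [exact: finite_set2|exact: finite_image].
move=> x [->|->|[n act ->]]; [by left; left|by left; right|right].
exists n => //; rewrite /= ltnNge; apply/negP => Nn; move: act.
by rewrite !(subdivision1 (subd y) tN) ?ltxx // leqW ?leqW.
Qed.

(** The values at [y'] near [y] are among finitely many points if [y] is
    outside [X], and close to [y] if [y] is in [X].  Hence a property that holds
    near each point of [A] holds at all values of the points near [y], if these
    are in [A].  Stated with a parameter [i], this serves the compactness of
    sets of values, local bounds, and the continuity at the points of [X]. *)
Lemma near_values (I : Type) (F : set_system I) (y : Y) (A : set X) (P : I -> X -> Prop) :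
    Filter F -> (forall x, A x -> \forall x' \near x & i \near F, P i x') ->
    values y `<=` A ->
  \forall y' \near y & i \near F, values y' `<=` A -> forall x, values y' x -> P i x.
Proof.
move=> FF HP yA.
have HP0 x : A x -> \forall i \near F, P i x.
  move=> /HP[[B C] [/= xB FC] BC]; apply: filterS FC => i Ci.
  by apply: (BC (x, i)); split=> //; exact: nbhs_singleton.
have Ha := HP0 a (yA a (Or31 _ _ erefl)); have Hb := HP0 b (yA b (Or32 _ _ erefl)).
have [Xy|Xy] := pselect (X y).
  pose x : X := SigSub (mem_set Xy); have yx : y = \val x by [].
  have Ax : A x by apply: yA; rewrite yx; exact: values_in.
  have [[V C] [/= xV FC] VC] := HP x Ax.
  exists ([set y' | forall n, tau n.+1 y' < tau n.+2 y' -> V (node n y')],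
    C `&` ((fun i => P i a) `&` (fun i => P i b))).
    by split; [rewrite yx; exact: (dg_node_near dg)|do !apply: filterI].
  move=> [y' i] [/= Oy' [Ci [ia ib]]] _ x' [->|->|[n act ->]] //.
  by apply: (VC (_, _)); split=> //; exact: Oy'.
have [N tN] := dg_finite dg Xy.
have Hn : \forall i \near F, forall n : 'I_N, A (node n y) -> P i (node n y).
  apply: filter_forall => n; have [/HP0|nA] := pselect (A (node n y)).
    by apply: filterS.
  by apply: nearW.
have Hc : \forall y' \near y, forall n : 'I_N,
    tau n.+2 y' = tau n.+1 y' \/ node n y' = node n y.
  by apply: filter_forall => n; exact: dg_node_const.
exists ((fun y' => tau N y' = 1) `&` [set y' | forall n : 'I_N,
    tau n.+2 y' = tau n.+1 y' \/ node n y' = node n y],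
  [set i | forall n : 'I_N, A (node n y) -> P i (node n y)] `&`
    ((fun i => P i a) `&` (fun i => P i b))).
  by split; do ?apply: filterI.
move=> [y' i] /= [[tN' Hy'] [Hi [ia ib]]] y'A x [->|->|[n act e]] //.
have nN : (n < N)%N.
  rewrite ltnNge; apply/negP => Nn; move: act.
  by rewrite !(subdivision1 (subd y') tN') ?ltxx // leqW ?leqW.
have [e2|e2] := Hy' (Ordinal nN); first by move: act; rewrite e2 ltxx.
rewrite e e2; apply: (Hi (Ordinal nN)); rewrite -e2 -e; apply: y'A.
by apply: Or33; exists n.
Qed.

Lemma compact_values (K : set Y) : compact K -> compact (\bigcup_(y in K) values y).
Proof.
move=> /compact_near_coveringP/near_covering_withinP cK.
apply/compact_near_coveringP => I F P FF HP.
have := cK I F (fun i y => forall x, values y x -> P i x) FF.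
move=> H; have : \forall i \near F, K `<=` [set y | forall x, values y x -> P i x].
  apply: H => y Ky; have sub y' : K y' -> values y' `<=` \bigcup_(y in K) values y.
    by move=> Ky'; exact: bigcup_sup.
  have [VW nVW VWP] := near_values FF HP (sub y Ky).
  by exists VW => // -[y' i] /VWP H' Ky'; apply: H'; exact: sub.
by apply: filterS => i Hi x [y Ky yx]; exact: Hi yx.
Qed.

(** The nodes are constant along [F] as far as they matter.  This holds for
    the neighbourhoods of [y] outside [X], and trivially for the filter
    generated by a single point, which may be in [X]. *)
Definition tame (F : set_system Y) y :=
  [/\ F --> y, forall n, tau n z @[z --> F] --> tau n y,
      exists N, tau N y = 1 /\ \forall z \near F, tau N z = 1 &
      forall n, \forall z \near F, tau n.+2 z = tau n.+1 z \/ node n z = node n y].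

Lemma tame_nbhs y : ~ X y -> tame (nbhs y) y.
Proof.
move=> Xy; split=> //.
- by move=> n; exact: (dg_continuous dg).
- by have [N tN] := dg_finite dg Xy; exists N; split=> //; exact: nbhs_singleton tN.
- by move=> n; exact: (dg_node_const dg).
Qed.

Lemma tame_globally y : tame (globally [set y]) y.
Proof.
split.
- by move=> A /nbhs_singleton Ay _ ->.
- by move=> n A /nbhs_singleton Ay _ ->.
- by have [_ _ _ [N tN]] := subd y; exists N; split=> // _ ->.
- by move=> n _ ->; right.
Qed.

(** Eventually the extension is a finite sum with a fixed number of terms; the
    overlaps converge, and their coefficients are constant except for
    the coefficient of the two symbols, which depends on [d]. *)
Lemma cvg_pair_ext_tame p (F F' : set_system Y) {FF : Filter F} {FF' : Filter F'} y y' :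
  tame F y -> tame F' y' ->
  pair_ext p z @[z --> filter_prod F F'] --> pair_ext p (y, y').
Proof.
move=> [Fy Ft [N [yN FN]] Fc] [Fy' Ft' [N' [yN' FN']] Fc'].
pose C (n m : nat) (z : Y * Y) : R := cone_ext p
  (if n is k.+1 then inl (node k y) else inr z.1) (if m is k.+1 then inl (node k y') else inr z.2).
have nearfst (P : Y -> Prop) : (\forall y \near F, P y) -> \forall z \near filter_prod F F', P z.1.
  exact: cvg_fst.
have nearsnd (P : Y -> Prop) : (\forall y \near F', P y) -> \forall z \near filter_prod F F', P z.2.
  exact: cvg_snd.
have nearE : {near filter_prod F F',
    (fun z => \sum_(n < N) \sum_(m < N')
      overlap (tau^~ z.1) (tau^~ z.2) n m * C n m z) =1 pair_ext p}.
  have H1 : \forall z \near filter_prod F F', forall n : 'I_N,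
      tau n.+2 z.1 = tau n.+1 z.1 \/ node n z.1 = node n y.
    by apply: filter_forall => n; apply: (nearfst _ (Fc n)).
  have H2 : \forall z \near filter_prod F F', forall m : 'I_N',
      tau m.+2 z.2 = tau m.+1 z.2 \/ node m z.2 = node m y'.
    by apply: filter_forall => n; apply: (nearsnd _ (Fc' n)).
  have H3 : \forall z \near filter_prod F F', tau N z.1 = 1 /\ tau N' z.2 = 1.
    by apply: filterI; [exact: (nearfst _ FN)|exact: (nearsnd _ FN')].
  apply: (@filterS3 _ (filter_prod F F') _ _ _ _ _ _ H1 H2 H3) => -[u v] /= K1 K2 [uN vN].
  rewrite /pair_ext (pairing_widen _ (subd u) (subd v) uN vN) /=.
  apply: eq_bigr => n _; apply: eq_bigr => m _.
  have P1 : overlap (tau^~ u) (tau^~ v) n m = 0 \/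
     point n u = (if n : nat is k.+1 then inl (node k y) else inr u).
    case: n => -[|n] nN /=; first by right.
    have [e|->] := K1 (Ordinal (ltnW nN)); last by right.
    by left; rewrite overlap_eq0l.
  have P2 : overlap (tau^~ u) (tau^~ v) n m = 0 \/
     point m v = (if m : nat is k.+1 then inl (node k y') else inr v).
    case: m {P1} => -[|m] mN /=; first by right.
    have [e|->] := K2 (Ordinal (ltnW mN)); last by right.
    by left; rewrite overlap_eq0r.
  case: P1 => [->|->]; first by rewrite !mul0r.
  by case: P2 => [->|->]; first by rewrite !mul0r.
apply: cvg_trans (near_eq_cvg nearE) _.
have := pairing_widen (fun n m => cone_ext p (point n y) (point m y')) (subd y) (subd y') yN yN'.
rewrite -/(pair_ext p (y, y')) => ->.
apply: cvg_sum_seq => n; apply: cvg_sum_seq => m; apply: (@cvgM R).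
  have t1 k : tau k z.1 @[z --> filter_prod F F'] --> tau k y.
    by apply: (@cvg_comp _ _ _ fst (tau k) _ _ _ cvg_fst); exact: Ft.
  have t2 k : tau k z.2 @[z --> filter_prod F F'] --> tau k y'.
    by apply: (@cvg_comp _ _ _ snd (tau k) _ _ _ cvg_snd); exact: Ft'.
  by rewrite /overlap; apply: (@cvgD _ R^o); [apply: (@cvgB _ R^o); [apply: (@cvgB _ R^o)|]|];
    exact: cvg_minr.
case: n m => -[|n] nN [[|m] mN] /=; try exact: cvg_cst.
have cd : d z @[z --> filter_prod F F'] --> d (y, y').
  move=> A /dc [[B B'] [/= yB yB'] sub]; exists (B, B') => //.
  by split; [exact: Fy|exact: Fy'].
have cd' : d (z.1, z.2) @[z --> filter_prod F F'] --> d (y, y').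
  by apply: cvg_trans cd; apply: near_eq_cvg; apply: nearW => -[].
apply: (@cvgM R); last exact: cvg_cst.
apply: (@cvgD _ R^o); apply: (@cvgM R); try exact: cvg_cst; last exact: cd'.
by apply: (@cvgB _ R^o); [exact: cvg_cst|exact: cd'].
Qed.

(** The value at a point of [X] does not depend on the subdivision used for that
    point, so it may be computed with the subdivision of any other point. *)
Lemma pair_ext_base p (x0 : X) y y' : pair_ext p (\val x0, y') =
  pairing (tau^~ y) (tau^~ y') (fun _ m => cone_ext p (inl x0) (point m y')).
Proof.
rewrite -[RHS](pairingC _ _ (fun m _ => cone_ext p (inl x0) (point m y'))).
rewrite (pairing_marginall (fun m => cone_ext p (inl x0) (point m y'))) //.
rewrite -(pairing_marginall (fun m => cone_ext p (inl x0) (point m y'))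
  (subd y') (subd (\val x0))) pairingC.
apply: eq_pairing => n m /eqP; rewrite neq_lt ltNge overlap_ge0 //=.
by move=> /(overlap_gt0 (subd _) (subd _))[nact mact]; rewrite (point_in dg) ?subr_gt0.
Qed.

(** Near [x0] in [X] the symbol has a small weight and a bounded contribution,
    and the nodes are close to [x0]. *)
Lemma pair_ext_near_base p (x0 : X) (y0 : Y) (e : R) : continuous p -> 0 < e ->
  \forall z \near (\val x0, y0), `|pair_ext p z - pair_ext p (\val x0, z.2)| <= e.
Proof.
move=> cp e0; have e20 : 0 < e / 2 by rewrite divr_gt0.
have cpx (x x1 : X) : p (z.2, z.1) @[z --> (x, x1)] --> p (x1, x).
  apply: (@continuous_comp _ _ _ (fun z : X * X => (z.2, z.1)) p (x, x1)); last exact: cp.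
  exact: swap_continuous.
have cpc (x x1 : X) : p (x1, z) @[z --> x] --> p (x1, x).
  apply: (@continuous_comp _ _ _ (fun z : X => (x1, z)) p x); last exact: cp.
  exact: pairl_continuous.
(* [p (x1, _)] is close to [p (x0, _)] at all values, if [x1] is close to [x0] *)
have [[V1 O] /= [V1y Ox] close] : \forall y' \near y0 & x1 \near x0,
    values y' `<=` setT -> forall x, values y' x -> `|p (x1, x) - p (x0, x)| <= e / 2.
  apply: (@near_values _ (nbhs x0) y0 setT
    (fun x1 x => `|p (x1, x) - p (x0, x)| <= e / 2)) => // x _.
  have c0 : p (z.2, z.1) - p (x0, z.1) @[z --> (x, x0)] --> (0 : R).
    rewrite -(subrr (p (x0, x))); apply: (@cvgB _ R^o); first exact: cpx.
    by apply: (@cvg_comp _ _ _ fst (fun t => p (x0, t)) _ _ _ cvg_fst); exact: cpc.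
  exact: cvgr0_norm_le c0 _ e20.
(* [p] is bounded at all values near [y0] by a number [M] fixed in advance *)
have [[V2 B] /= [V2y Boo] bnd] : \forall y' \near y0 & M \near +oo,
    values y' `<=` setT -> forall x, values y' x ->
    [/\ `|p (x0, x)| <= M, `|p (a, x)| <= M & `|p (b, x)| <= M].
  have pM (x x1 : X) : \forall z \near x, `|p (x1, z)| <= `|p (x1, x)| + 1.
    have /cvgrPdist_le/(_ _ ltr01) := cpc x x1; apply: filterS => z H /=.
    have := ler_normB (p (x1, x)) (p (x1, x) - p (x1, z)).
    by rewrite opprB addrC subrK; lra.
  apply: (@near_values _ (+oo : set_system R) y0 setT (fun M x =>
    [/\ `|p (x0, x)| <= M, `|p (a, x)| <= M & `|p (b, x)| <= M])) => // x _.
  exists ([set z | [/\ `|p (x0, z)| <= `|p (x0, x)| + 1, `|p (a, z)| <= `|p (a, x)| + 1 &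
      `|p (b, z)| <= `|p (b, x)| + 1]],
    [set M | `|p (x0, x)| + `|p (a, x)| + `|p (b, x)| + 1 <= M]).
    split; last exact: nbhs_pinfty_ge.
    by apply: filterS3 (pM x x0) (pM x a) (pM x b) => z; split.
  move=> [z M] [/= [? ? ?] ?]; have := normr_ge0 (p (x0, x)).
  have := normr_ge0 (p (a, x)); have := normr_ge0 (p (b, x)).
  by split; lra.
have [M BM] : exists M, B M by exact: filter_ex Boo.
have t0 : tau 1%N z @[z --> \val x0] --> (0 : R).
  by rewrite -(dg_weight_in dg (set_valP x0)); exact: (dg_weight_continuous dg).
have t1 : tau 1%N z * (2 * M) @[z --> \val x0] --> (0 : R).
  by rewrite -(mul0r (2 * M)); apply: (@cvgM R) => //; exact: cvg_cst.
have N1 : \forall y \near \val x0, tau 1%N y * (2 * M) <= e / 2.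
  have /cvgr0_norm_le/(_ _ e20) := t1.
  by apply: filterS => y; rewrite ler_norml => /andP[].
have N2 := dg_node_near dg Ox.
exists ([set y | tau 1%N y * (2 * M) <= e / 2 /\
    forall n, tau n.+1 y < tau n.+2 y -> O (node n y)], V1 `&` V2).
  by split; apply: filterI.
move=> [y y'] [/= [tM yO] [V1y' V2y']].
have {}close x1 x : O x1 -> values y' x -> `|p (x1, x) - p (x0, x)| <= e / 2.
  by move=> Ox1; exact: (close (y', x1) (conj V1y' Ox1) _ x).
have {}bnd x : values y' x -> [/\ `|p (x0, x)| <= M, `|p (a, x)| <= M & `|p (b, x)| <= M].
  exact: (bnd (y', M) (conj V2y' BM) _ x).
rewrite (pair_ext_base p x0 y y') -pairingB.
pose G (n m : nat) : R := e / 2 + (if n is 0%N then 2 * M else 0).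
have GE : pairing (tau^~ y) (tau^~ y') G <= e.
  rewrite pairingD pairing_cst // pairing_firstl //.
  by have := tM; lra.
apply: le_trans GE; apply: ler_norm_pairing => // n m o0.
have [nact mact] := overlap_gt0 (subd _) (subd _) o0.
have sub := @support_values _ _ _ tau node a b m y' mact.
have sa : exists2 x, support (point m y') x & True.
  by case: (point m y') => [x|t]; [exists x|exists a => //; left].
case: n nact {o0} => [|n] nact; rewrite /G.
  have H0 : - M <= cone_ext p (inl x0) (point m y') <= M.
    apply: (cone_ext_bound dm d1) => x x' -> /sub/bnd[H _ _].
    by rewrite -ler_norml.
  have H1 : - M <= cone_ext p (point 0 y) (point m y') <= M.
    apply: (cone_ext_bound dm d1) => x x' [->|->] /sub/bnd[_ Ha Hb];
    by rewrite -ler_norml.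
  by rewrite ler_norml; apply/andP; split; lra.
rewrite addr0; have On := yO n nact.
case: (point m y') sub => [x'|t] sub /=; first by apply: close => //; exact: sub.
have ca := close _ _ On (sub a (or_introl erefl)).
have cb := close _ _ On (sub b (or_intror erefl)).
move: ca cb; rewrite !ler_norml => /andP[? ?] /andP[? ?]; apply/andP; split; lra.
Qed.

Lemma pair_ext_swap p y y' :
  pair_ext (fun z => p (z.2, z.1)) (y', y) = pair_ext p (y, y').
Proof.
have [[_ _ ds _] _] := dm.
rewrite /pair_ext pairingC; apply: eq_pairing => n m _ /=.
case: (point n y) (point m y') => [x|u] [x'|v] //=.
by rewrite (ds v u) [p (b, a) + _]addrC.
Qed.

(** If one of the points is in [X], the extension is compared with its value
    where that point is fixed; if none is, the filters are tame. *)
Lemma pair_ext_continuous p : continuous p -> continuous (pair_ext p).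
Proof.
move=> cp.
have cT q : continuous q -> continuous (fun z : X * X => q (z.2, z.1)).
  move=> cq z; apply: (@continuous_comp _ _ _ (fun z : X * X => (z.2, z.1)) q z); last exact: cq.
  exact: swap_continuous.
(* continuity at the points whose first coordinate lies in X *)
have half q (x0 : X) y' : continuous q -> pair_ext q @ (\val x0, y') --> pair_ext q (\val x0, y').
  move=> cq.
  have c2 : pair_ext q (\val x0, y) @[y --> y'] --> pair_ext q (\val x0, y').
    have [Xy'|Xy'] := pselect (X y').
      pose x1 : X := SigSub (mem_set Xy').
      apply/cvgrPdist_le => e e0.
      have [[V W] /= [Vx Wx] H] := @pair_ext_near_base _ x1 (\val x0) _ (cT q cq) e0.
      apply: filterS Vx => y Vy; have := H (y, \val x0) (conj Vy (nbhs_singleton Wx)).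
      by rewrite !pair_ext_swap distrC.
    have := @cvg_pair_ext_tame q _ _ _ _ _ _ (tame_globally (\val x0)) (tame_nbhs Xy').
    move=> H A /H[[V W] /= [Vx Wy] sub]; apply: filterS Wy => y Wy.
    by apply: (sub (\val x0, y)); split=> //; exact: Vx.
  have c3 : pair_ext q (\val x0, z.2) @[z --> (\val x0, y')] --> pair_ext q (\val x0, y').
    by apply: (@cvg_comp _ _ _ snd (fun t => pair_ext q (\val x0, t)) _ _ _ cvg_snd); exact: c2.
  have c4 : pair_ext q z - pair_ext q (\val x0, z.2) @[z --> (\val x0, y')] --> (0 : R).
    apply/cvgrPdist_le => e e0; have := @pair_ext_near_base q x0 y' e cq e0.
    by apply: filterS => z; rewrite sub0r normrN.
  rewrite (_ : pair_ext q = (fun z => (pair_ext q z - pair_ext q (\val x0, z.2)) +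
    pair_ext q (\val x0, z.2))); last by apply/funext => z; rewrite subrK.
  by rewrite /= subrK -[X in _ --> X]add0r; apply: (@cvgD _ R^o).
move=> [y y'].
have [Xy|Xy] := pselect (X y); first exact: (half p (SigSub (mem_set Xy)) y' cp).
have [Xy'|Xy'] := pselect (X y'); last exact: cvg_pair_ext_tame (tame_nbhs Xy) (tame_nbhs Xy').
have := half _ (SigSub (mem_set Xy')) y (cT p cp); rewrite /= => H.
have sw : (z.2, z.1) @[z --> (y, y')] --> (y', y).
  exact: (@swap_continuous Y Y (y, y')).
rewrite (_ : pair_ext p = pair_ext (fun z => p (z.2, z.1)) \o (fun z => (z.2, z.1))).
  exact: cvg_comp sw H.
by apply/funext => -[u v] /=; rewrite pair_ext_swap.
Qed.

End extension_topology.

(** * Admissible metrics *)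

Section domination.
Context {R : realType} {Y : topologicalType} {X : set Y}.
Variables (d : Y * Y -> R) (tau : nat -> Y -> R) (node : nat -> Y -> X) (a b : X).
Hypotheses (dm : is_metric d) (d1 : forall z, d z <= 1) (dc : continuous d) (ab : a <> b).
Hypothesis dg : dugundji_system tau node.
Hypothesis d_dom : dominating d.
Hypothesis node_close : forall y n, tau n.+1 y < tau n.+2 y ->
  d (y, \val (node n y)) <= 3 * tau 1%N y.

Let subd y : subdivision (tau^~ y). Proof. exact: (dg_subdivision dg). Qed.
Hint Resolve subd : core.
Local Notation pair_ext := (pair_ext d tau node a b).

(** Outside [X], a small extension forces the weights of the symbols to be
    close, hence the symbols to be close for [d].  At a point of [X], it forces
    the weight of the symbol of [y] to be small, hence [y] to be close to its
    nodes, one of which is close to the given point. *)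
Lemma pair_ext_dominating p : is_metric p -> dominating p -> dominating (pair_ext p).
Proof.
move=> pm p_dom y0 U U0.
have [pp _] := pm; have [p0 _ ps _] := pp; have [[d0 _ ds dt] _] := dm.
have [e0 _ es _] := pair_ext_pseudometric a b dm d1 dg pp.
set c := p (a, b); have c0 : 0 < c := base_gt0 ab pm.
have [r /= r0 rU] := d_dom U0.
have [Xy0|Xy0] := pselect (X y0).
  pose x0 : X := SigSub (mem_set Xy0).
  have oV : open [set y | d (\val x0, y) < r / 2].
    apply/open_nearP => y /= H.
    have cd : d (\val x0, z) @[z --> y] --> d (\val x0, y).
      apply: (@continuous_comp _ _ _ (fun z => (\val x0, z)) d y); last exact: dc.
      exact: pairl_continuous.
    exact: cvgr_lt cd _ H.
  have Vx0 : d (\val x0, \val x0) < r / 2.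
    by have [[_ -> _ _] _] := dm; rewrite divr_gt0.
  have [q /= q0 qV] := p_dom x0 _ (near_set_type oV Vx0).
  exists (Num.min (c / 4) (Num.min (c * r / 12) (q / 2))).
    by rewrite /= !lt_min !divr_gt0 // mulr_gt0.
  move=> y /=; rewrite !lt_min => /andP[e1 /andP[e2 e3]]; apply: rU => /=.
  have := pair_ext_weight dm d1 ab dg pm y y0.
  rewrite (dg_weight_in dg Xy0) subr0 es -/c => Hw.
  set l := tau 1%N y in Hw.
  have l0 : 0 <= l := subdivision_ge0 1%N (subd y).
  have l1 : l < 1 / 2 by rewrite -(ltr_pM2r c0); lra.
  have l2 : 3 * l < r / 2 by rewrite -(ltr_pM2r c0); lra.
  (* otherwise all nodes of [y] are far from [x0], and the extension is large *)
  have [m [mact mq]] : exists m, tau m.+1 y < tau m.+2 y /\ p (x0, node m y) < q.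
    apply: contrapT => nex.
    have : q - l * q <= pair_ext p (y0, y).
      have -> : q - l * q = pairing (tau^~ y0) (tau^~ y) (fun _ _ => q) -
          pairing (tau^~ y0) (tau^~ y) (fun _ m => if m is 0%N then q else 0).
        by rewrite pairing_cst // pairing_firstr.
      rewrite -pairingB; apply: ler_pairing => // n m o0.
      have [nact mact] := overlap_gt0 (subd y0) (subd y) o0.
      rewrite [point node n y0](@point_in R Y X tau node dg n x0) ?subr_gt0 //.
      case: m mact {o0} => [|m] mact /=.
        by rewrite subrr divr_ge0 ?addr_ge0.
      by rewrite subr0 leNgt; apply/negP => H; apply: nex; exists m.
    have : l * q <= 1 / 2 * q by rewrite ler_pM2r // ltW.
    lra.
  have := dt y0 (\val (node m y)) y; have := node_close mact.
  have := qV _ mq; rewrite /= (ds (\val (node m y))) -/l; lra.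
have l0 := dg_weight_out dg Xy0; set l := tau 1%N y0 in l0.
exists (Num.min (c * l / 4) (r * (c * l) / 2)).
  by rewrite /= lt_min !divr_gt0 // ?mulr_gt0.
move=> y /=; rewrite lt_min => /andP[e1 e2]; apply: rU => /=.
have := pair_ext_weight dm d1 ab dg pm y0 y.
have := pair_ext_symbols a b dm d1 dg pm y0 y.
rewrite -/c -/l; set l' := tau 1%N y => H1 H2.
have H3 : l / 2 < l' by rewrite -(ltr_pM2r c0); lra.
have H4 : l / 2 <= Num.min l l'.
  by rewrite le_min (ltW H3) andbT ler_pdivrMr // ler_peMr ?ltW // ltr1n.
have H5 : l / 2 * (d (y0, y) * c) <= pair_ext p (y0, y).
  by apply: le_trans H1; rewrite ler_wpM2r // mulr_ge0 // ltW.
have cl0 : 0 < c * l / 2 by rewrite divr_gt0 // mulr_gt0.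
rewrite -(ltr_pM2r cl0); apply: (@le_lt_trans _ _ (pair_ext p (y0, y))).
  by apply: le_trans H5; rewrite le_eqVlt; apply/orP; left; apply/eqP; field.
by apply: lt_le_trans e2 _; rewrite -(mulrA r).
Qed.

End domination.

(** * Averaging over the group *)

Lemma compact_open_cvg_unifP (R : realType) (Z : topologicalType)
    (F : set_system (Z -> R)) (f : Z -> R) : Filter F -> continuous f ->
  {compact-open, F --> f} <-> forall K, compact K -> forall e : R, 0 < e ->
    \forall h \near F, forall z, K z -> `|f z - h z| < e.
Proof.
move=> FF cf; rewrite compact_open_fam_compactP // fam_cvgP; split=> H K cK.
  move=> e e0; apply: (H K cK); apply/uniform_nbhs.
  exists [set xy | `|xy.1 - xy.2| < e]; split; last by move=> h Hh z Kz; exact: Hh.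
  by rewrite -entourage_ballE; exists e.
move=> P PP; have [E [entE EP]] := (@uniform_nbhs _ _ _ _ _).1 PP.
move: entE; rewrite -entourage_ballE => -[e /= e0 eE].
by apply: filterS (H K cK e e0) => h Hh; apply: EP => z Kz; apply: eE; exact: Hh.
Qed.

Section averaging.
Context {R : realType} {G : topologicalGroupType} {Y : topologicalType}.
Variable act : G -> Y -> Y.
Hypothesis Gcompact : compact [set: G].
Hypothesis act_cont : continuous_action act.
Implicit Types f : Y * Y -> R.

Definition diag_act g (z : Y * Y) : Y * Y := (act g z.1, act g z.2).

Definition average f z : R := mean (fun g => f (diag_act g z)).

Lemma diag_act_continuous : continuous (fun gz : G * (Y * Y) => diag_act gz.1 gz.2).
Proof.
move=> [g [y y']]; have [_ _ ca] := act_cont.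
have c1 : act gz.1 gz.2.1 @[gz --> (g, (y, y'))] --> act g y.
  apply: (@cvg_comp _ _ _ (fun gz : G * (Y * Y) => (gz.1, gz.2.1)) (fun gy => act gy.1 gy.2)
    _ (nbhs (g, y)) _ _ (ca (g, y))).
  apply: cvg_pair; first exact: cvg_fst.
  by apply: (@cvg_comp _ _ _ snd fst _ _ _ cvg_snd); exact: cvg_fst.
have c2 : act gz.1 gz.2.2 @[gz --> (g, (y, y'))] --> act g y'.
  apply: (@cvg_comp _ _ _ (fun gz : G * (Y * Y) => (gz.1, gz.2.2)) (fun gy => act gy.1 gy.2)
    _ (nbhs (g, y')) _ _ (ca (g, y'))).
  apply: cvg_pair; first exact: cvg_fst.
  by apply: (@cvg_comp _ _ _ snd snd _ _ _ cvg_snd); exact: cvg_snd.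
exact: cvg_pair c1 c2.
Qed.

Lemma orbit_continuous f z : continuous f -> continuous (fun g => f (diag_act g z)).
Proof.
move=> cf g; apply: (@continuous_comp _ _ _ (fun g => (g, z)) (fun gz => f (diag_act gz.1 gz.2))).
  exact: pairr_continuous.
apply: (@continuous_comp _ _ _ (fun gz : G * (Y * Y) => diag_act gz.1 gz.2) f); last exact: cf.
exact: diag_act_continuous.
Qed.

Lemma average_bound f z c e : continuous f ->
  (forall g, c <= f (diag_act g z) <= e) -> c <= average f z <= e.
Proof.
move=> cf H; have co := orbit_continuous (z := z) cf.
by rewrite mean_ge ?mean_le // => g; have /andP[] := H g.
Qed.

Lemma average_linear c f f' z : continuous f -> continuous f' ->
  average (fun z => c * f z + f' z) z = c * average f z + average f' z.
Proof.
move=> cf cf'; rewrite /average meanD ?meanZ //; try exact: orbit_continuous.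
move=> g; apply: (@cvgM R); first exact: cvg_cst.
exact: orbit_continuous.
Qed.

Lemma average_invariant f h y y' : continuous f ->
  average f (act h y, act h y') = average f (y, y').
Proof.
move=> cf; have [_ aM _] := act_cont.
rewrite /average -(mean_translate Gcompact h (orbit_continuous (z := (y, y')) cf)).
by congr mean; apply/funext => g; rewrite /diag_act /= !aM.
Qed.

Lemma average_id f z : (forall g, f (diag_act g z) = f z) -> average f z = f z.
Proof.
by move=> H; rewrite /average (_ : (fun _ => _) = fun=> f z) ?mean_cst //; apply/funext.
Qed.

Lemma average_continuous f : continuous f -> continuous (average f).
Proof.
move=> cf z; apply/cvgrPdist_le => e e0.
have /compact_near_coveringP := Gcompact.
move=> /(_ _ (nbhs z) (fun w g => `|f (diag_act g z) - f (diag_act g w)| <= e)) H.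
have : \forall w \near z, [set: G] `<=` [set g | `|f (diag_act g z) - f (diag_act g w)| <= e].
  apply: H => g _.
  have c1 : f (diag_act gw.1 gw.2) @[gw --> (g, z)] --> f (diag_act g z).
    apply: (@continuous_comp _ _ _ (fun gz : G * (Y * Y) => diag_act gz.1 gz.2) f (g, z));
      last exact: cf.
    exact: diag_act_continuous.
  have c2 : f (diag_act gw.1 z) @[gw --> (g, z)] --> f (diag_act g z).
    apply: (@cvg_comp _ _ _ fst (fun g => f (diag_act g z)) _ _ _ cvg_fst).
    exact: orbit_continuous.
  have c3 : f (diag_act gw.1 z) - f (diag_act gw.1 gw.2) @[gw --> (g, z)] --> (0 : R).
    by rewrite -(subrr (f (diag_act g z))); exact: cvgB.
  exact: cvgr0_norm_le c3 _ e0.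
apply: filterS => w Hw; rewrite -mulN1r addrC.
have cz := orbit_continuous (z := z) cf; have cw := orbit_continuous (z := w) cf.
have cN : continuous (fun g => -1 * f (diag_act g w)).
  by move=> g; apply: (@cvgM R); [exact: cvg_cst|exact: cw].
rewrite -meanZ // -meanD //; apply: mean_norm_le => //.
  by move=> g; apply: (@cvgD _ R^o); [exact: cN|exact: cz].
by move=> g; rewrite mulN1r addrC; exact: Hw.
Qed.

Lemma average_pseudometric f : continuous f -> is_pseudometric f -> is_pseudometric (average f).
Proof.
move=> cf [f0 fxx fs ft]; have co z := orbit_continuous (z := z) cf.
split.
- by move=> y y'; apply: mean_ge => // g; exact: f0.
- by move=> y; rewrite /average /diag_act /= (_ : (fun _ => _) = fun=> 0) ?mean_cst //;
    apply/funext => g; exact: fxx.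
- by move=> y y'; congr mean; apply/funext => g; exact: fs.
- move=> x y z; rewrite /average -meanD //; apply: mean_monotone => //.
    by move=> g; apply: (@cvgD _ R^o); exact: co.
  by move=> g; exact: ft.
Qed.

Lemma average_metric f : continuous f -> is_metric f -> is_metric (average f).
Proof.
move=> cf [pf fe]; split; first exact: average_pseudometric.
move=> y y' e0; apply: contrapT => yy'; have [f0 _ _ _] := pf.
have [a1 _ _] := act_cont.
have : 0 < average f (y, y').
  apply: mean_gt0 => //; first exact: orbit_continuous.
    by move=> g; exact: f0.
  rewrite /diag_act /= !a1 lt_neqAle f0 andbT eq_sym; apply/eqP => fy.
  exact/yy'/fe.
by rewrite e0 ltxx.
Qed.

(** If the average is less than [e], then so is the value at some translate
    by [g].  Domination at [act g y] brings [act g y'] close to [act g y], and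
    the inverse of [g] brings [y'] close to [y]; the compactness of [G] makes [e]
    independent of [g]. *)
Lemma average_dominating f : continuous f -> is_pseudometric f -> dominating f ->
  dominating (average f).
Proof.
move=> cf [f0 fxx fs ft] fd y U Uy.
have [a1 aM ca] := act_cont.
have /compact_near_coveringP := Gcompact.
move=> /(_ _ (0^'+ : set_system R) (fun e g => forall y', f (act g y, act g y') < e -> U y')) H.
have : \forall e \near (0^'+ : set_system R),
    [set: G] `<=` [set g | forall y', f (act g y, act g y') < e -> U y'].
  apply: H => g _.
  have cg : act hz.1^-1%g hz.2 @[hz --> (g, act g y)] --> y.
    have {2}-> : y = act (g, act g y).1^-1%g (g, act g y).2 by rewrite /= -aM mulVg a1.
    apply: (@continuous_comp _ _ _ (fun hz : G * Y => (hz.1^-1%g, hz.2))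
      (fun gy => act gy.1 gy.2)); last exact: ca.
    apply: cvg_pair => /=; last exact: cvg_snd.
    by apply: (@cvg_comp _ _ _ fst (fun g => g^-1%g) _ _ _ cvg_fst); exact: invg_continuous.
  have [[N W] /= [gN gW] NW] := cg U Uy.
  have [r /= r0 rW] := fd (act g y) W gW.
  have r20 : 0 < r / 2 by rewrite divr_gt0.
  have cN : \forall h \near g, f (act g y, act h y) < r / 2.
    have c : f (act g y, act h y) @[h --> g] --> f (act g y, act g y).
      apply: (@continuous_comp _ _ _ (fun h => (act g y, act h y)) f); last exact: cf.
      apply: cvg_pair => /=; first exact: cvg_cst.
      apply: (@continuous_comp _ _ _ (fun h => (h, y)) (fun gy => act gy.1 gy.2)); last exact: ca.
      exact: pairr_continuous.
    by apply: (cvgr_lt _ c); rewrite fxx.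
  exists (N `&` (fun h => f (act g y, act h y) < r / 2), [set e | e <= r / 2]).
    by split; [exact: filterI|exact: nbhs_right_le].
  move=> [h e] /= [[Nh hr] er] y' fh.
  have Wh : W (act h y').
    by apply: rW => /=; apply: le_lt_trans (ft _ (act h y) _) _; lra.
  by have := NW (h, act h y') (conj Nh Wh); rewrite /= -aM mulVg a1.
move=> H'; have [e [e0 He]] : exists e : R, 0 < e /\
    forall g y', f (act g y, act g y') < e -> U y'.
  have : \forall e \near (0^'+ : set_system R), 0 < e by exact: nbhs_right_gt.
  move=> P; have [e [e0 He]] := filter_ex (filterI P H').
  by exists e; split=> // g y'; exact: He.
exists e => // y' /= ae; apply: contrapT => nU; move: ae; rewrite ltNge => /negP; apply.
apply: mean_ge => //; first exact: orbit_continuous.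
by move=> g; rewrite leNgt; apply/negP => /He.
Qed.

End averaging.

(** * The extension operator *)

(** If [Y] is metrizable the data come from an admissible metric, since
    the metric and the cover made from a stratification need not dominate. *)
Lemma ex_extension_data (R : realType) (Y : topologicalType) (X : set Y) (x0 : X) :
    stratifiable Y -> closed X ->
  exists (d : Y * Y -> R) (tau : nat -> Y -> R) (node : nat -> Y -> X),
    [/\ is_metric d, continuous d, forall z, d z <= 1, dugundji_system tau node &
     metrizable R Y -> dominating d /\ forall y n, tau n.+1 y < tau n.+2 y ->
       d (y, \val (node n y)) <= 3 * tau 1%N y].
Proof.
move=> [T1 [S SS]] cX; have [mY|nmY] := pselect (metrizable R Y).
  have [d [dm dc d1 d_dom]] := metrizable_bounded mY.
  have [U [a [oU UX Ua]]] := metric_cover dm dc d1 d_dom x0 cX.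
  have [[d0 dxx ds dt] _] := dm.
  have lc : continuous (set_dist d X) by exact: set_dist_continuous.
  have l1 y : set_dist d X y <= 1 by have /andP[] := set_dist01 dm d1 x0 y.
  have lin := set_dist_in dm d1 x0.
  have lout y : ~ X y -> 0 < set_dist d X y by exact: set_dist_gt0.
  have Ua' (x : X) (O : set Y) : open O -> O (\val x) ->
      \forall y \near \val x, forall w, U w y -> O (\val (a w)).
    move=> oO Ox; have [r /= r0 rO] := d_dom _ _ (open_nbhs_nbhs (conj oO Ox)).
    have c : d (y, \val x) @[y --> \val x] --> d (\val x, \val x).
      exact: (@dist_continuousl _ _ _ dc (\val x) (\val x)).
    have : \forall y \near \val x, d (y, \val x) < r / 4.
      by apply: (cvgr_lt _ c); rewrite dxx divr_gt0.
    apply: filterS => y dy w Uw; apply: rO => /=.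
    have := dt (\val x) y (\val (a w)); have := Ua y w Uw.
    by have := set_dist_le dm x0 y x; rewrite (ds (\val x) y); lra.
  have [tau [node [dg tau1 act]]] :=
    dugundji_systemP SS (\val x0) cX lc l1 lin lout oU UX Ua'.
  exists d, tau, node; split=> // _; split=> // y n nact.
  have [Xy|Xy] := pselect (X y).
    have -> : \val (node n y) = y by rewrite (dg_node_in dg n (SigSub (mem_set Xy))).
    by rewrite dxx (dg_weight_in dg Xy) mulr0.
  by have [w [Uw ->]] := act y n Xy nact; rewrite tau1; exact: Ua.
have [d [dm dc d1]] := stratified_metric (R := R) T1 SS (\val x0).
have [U [a [oU UX Ua]]] := dugundji_cover T1 SS x0 cX.
have [psi [pi [cpsi psi01 psiU _ psi_gt0]]] := partition_functions (R := R) SS (\val x0) oU.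
have lc := wsup_continuous psi01 cpsi.
have l1 y : wsup psi y <= 1 by have /andP[] := wsup01 psi01 y.
have lin y : X y -> wsup psi y = 0.
  move=> Xy; apply/eqP; rewrite eq_le; have /andP[-> _] := wsup01 psi01 y.
  rewrite andbT leNgt; apply/negP => /(wsup_gt0 psi01)[k /psiU Uy].
  by have /UX : exists w, U w y by exists (pi k y).
have lout y : ~ X y -> 0 < wsup psi y by move=> /UX /psi_gt0 H; apply/wsup_gt0.
have [tau [node [dg _ _]]] :=
  dugundji_systemP SS (\val x0) cX lc l1 lin lout oU UX Ua.
by exists d, tau, node; split.
Qed.

Section operator.
Context {R : realType} {G : topologicalGroupType} {Y : topologicalType}.
Variables (act : G -> Y -> Y) (X : set Y).
Hypotheses (Gcompact : compact [set: G]) (act_cont : continuous_action act).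
Hypothesis Xinv : invariant_set act X.
Variables (d : Y * Y -> R) (tau : nat -> Y -> R) (node : nat -> Y -> X) (a b : X).
Hypotheses (dm : is_metric d) (d1 : forall z, d z <= 1) (dc : continuous d) (ab : a <> b).
Hypothesis dg : dugundji_system tau node.

Local Notation pair_ext := (pair_ext d tau node a b).
Local Notation values := (values tau node a b).
Local Notation CX := (Cinv R (sub_act Xinv)).
Local Notation CY := (Cinv R act).

Lemma CinvP (H : Type) (Z : topologicalType) (h : H -> Z -> Z) (f : Cinv R h) :
  continuous f /\ forall g x y, f (h g x, h g y) = f (x, y).
Proof. by case: f => f /=; rewrite inE. Qed.

Definition extend (p : X * X -> R) : Y * Y -> R := average act (pair_ext p).

Let cpe (p : X * X -> R) : continuous p -> continuous (pair_ext p).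
Proof. exact: pair_ext_continuous. Qed.

Lemma extend_linear c (p q : X * X -> R) z : continuous p -> continuous q ->
  extend (fun t => c * p t + q t) z = c * extend p z + extend q z.
Proof.
move=> cp cq; rewrite /extend -(average_linear Gcompact act_cont) //; try exact: cpe.
by congr (average act _ z); apply/funext => w; exact: pair_ext_linear.
Qed.

Definition orbit_values (z : Y * Y) : set X :=
  \bigcup_(g in [set: G]) (values (act g z.1) `|` values (act g z.2)).

Lemma extend_bound (p : X * X -> R) z c e : continuous p ->
    (forall x x', orbit_values z x -> orbit_values z x' -> c <= p (x, x') <= e) ->
  c <= extend p z <= e.
Proof.
move=> cp H; apply: average_bound => //; first exact: cpe.
move=> g; apply: (pair_ext_bound dm d1 dg) => x x' vx vx'.
by apply: H; exists g => //; [left|right].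
Qed.

Lemma extend_ge0 (p : X * X -> R) z : continuous p ->
  (forall t, 0 <= p t) -> 0 <= extend p z.
Proof.
move=> cp p0; apply: mean_ge => //; first exact: (orbit_continuous act_cont (cpe cp)).
by move=> g; apply: (pair_ext_ge0 a b dm d1 dg).
Qed.

(** Both continuity statements follow: the set of values is compact over
    a compact set, and finite over a point if [G] is finite. *)
Lemma extend_dist (p q : X * X -> R) z e : continuous p -> continuous q ->
    (forall x x', orbit_values z x -> orbit_values z x' -> `|p (x, x') - q (x, x')| <= e) ->
  `|extend p z - extend q z| <= e.
Proof.
move=> cp cq H.
have -> : extend p z - extend q z = extend (fun t => -1 * q t + p t) z.
  by rewrite extend_linear // mulN1r addrC.
rewrite ler_norml; apply: extend_bound.
  move=> t; apply: (@cvgD _ R^o); last exact: cp.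
  by apply: (@cvgM R); [exact: cvg_cst|exact: cq].
by move=> x x' vx vx'; rewrite mulN1r addrC -ler_norml; exact: H.
Qed.

Lemma extendE (p : CX) (x x' : X) : extend p (\val x, \val x') = p (x, x').
Proof.
have pg g : pair_ext p (diag_act act g (\val x, \val x')) = p (x, x').
  have [_ Ip] := CinvP p.
  have -> : diag_act act g (\val x, \val x') =
    (\val (sub_act Xinv g x), \val (sub_act Xinv g x')) by [].
  by rewrite pair_ext_extends // Ip.
have p1 : pair_ext p (\val x, \val x') = p (x, x') by rewrite pair_ext_extends.
by rewrite /extend average_id // => g; rewrite pg p1.
Qed.

Lemma extend_Cinv (p : CX) : extend p \in Cinv_pred act.
Proof.
have [cp _] := CinvP p; rewrite inE; split.
  by apply: average_continuous => //; exact: cpe.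
by move=> g x y; apply: average_invariant => //; exact: cpe.
Qed.

Definition extend_op (p : CX) : CY := MkCinv (extend_Cinv p).

Lemma extend_op_linear : linear extend_op.
Proof.
move=> c p q; apply: val_inj => /=; apply/funext => z.
have [cp _] := CinvP p; have [cq _] := CinvP q.
exact: (extend_linear c z cp cq).
Qed.

HB.instance Definition _ := GRing.isLinear.Build R CX CY _ extend_op extend_op_linear.

Lemma compact_orbit_values (K : set (Y * Y)) : compact K ->
  compact (\bigcup_(z in K) orbit_values z).
Proof.
move=> cK.
pose D := (fun gz : G * (Y * Y) => diag_act act gz.1 gz.2) @` ([set: G] `*` K).
have cD : compact D.
  apply: continuous_compact; last exact: compact_setX.
  by apply: continuous_subspaceT; exact: diag_act_continuous.
have cD1 : compact (fst @` D).
  by apply: continuous_compact => //; apply: continuous_subspaceT => z; exact: cvg_fst.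
have cD2 : compact (snd @` D).
  by apply: continuous_compact => //; apply: continuous_subspaceT => z; exact: cvg_snd.
have -> : \bigcup_(z in K) orbit_values z = \bigcup_(y in fst @` D `|` snd @` D) values y.
  apply/seteqP; split=> [x [z Kz [g _ [vx|vx]]]|].
  - by exists (act g z.1) => //; left; exists (diag_act act g z) => //; exists (g, z).
  - by exists (act g z.2) => //; right; exists (diag_act act g z) => //; exists (g, z).
  move=> x [y [[_ [[g z] /= [_ Kz] <-] <-]|[_ [[g z] /= [_ Kz] <-] <-]] vx].
  - by exists z => //; exists g => //; left.
  - by exists z => //; exists g => //; right.
exact: (compact_values dg (compactU cD1 cD2)).
Qed.

Lemma extend_op_compact_open :
  continuous (extend_op : Cinv_compact_open R (sub_act Xinv) -> Cinv_compact_open R act).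
Proof.
apply: continuous_comp_initial => p.
have [cp _] := CinvP (p : CX); have [cTp _] := CinvP (extend_op p).
have FF : Filter ((@Cinv_fun R G Y act \o extend_op) x
    @[x --> (p : Cinv_compact_open R (sub_act Xinv))]).
  by apply: fmap_filter; exact: (@nbhs_filter (Cinv_compact_open R (sub_act Xinv)) p).
apply/compact_open_cvg_unifP => // K cK e e0.
have e20 : 0 < e / 2 by rewrite divr_gt0.
pose V := \bigcup_(z in K) orbit_values z.
have cV : compact V by exact: compact_orbit_values.
have ic : {compact-open, @Cinv_fun R G X (sub_act Xinv) @
    nbhs (p : Cinv_compact_open R (sub_act Xinv)) --> (p : CX)}.
  exact: (@initial_continuous CX {compact-open, (X * X)%type -> R}
    (@Cinv_fun R G X (sub_act Xinv)) p).
have FF' : Filter (@Cinv_fun R G X (sub_act Xinv) @ nbhs (p : Cinv_compact_open R (sub_act Xinv))).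
  by apply: fmap_filter; exact: (@nbhs_filter (Cinv_compact_open R (sub_act Xinv)) p).
have near_p : \forall q \near (p : Cinv_compact_open R (sub_act Xinv)),
    forall t, (V `*` V) t -> `|(p : CX) t - (q : CX) t| < e / 2.
  exact: (compact_open_cvg_unifP FF' cp).1 ic _ (compact_setX cV cV) _ e20.
apply: filterS near_p => q Hq z Kz.
have [cq _] := CinvP (q : CX).
apply: (@le_lt_trans _ _ (e / 2)); last by rewrite ltr_pdivrMr // mulr_natr mulr2n ltrDl.
apply: extend_dist => // x x' vx vx'; apply: ltW; apply: Hq.
by split; exists z.
Qed.

Lemma extend_op_ptws : finite_set [set: G] ->
  continuous (extend_op : Cinv_ptws R (sub_act Xinv) -> Cinv_ptws R act).
Proof.
move=> fG; apply: continuous_comp_initial => p.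
have [cp _] := CinvP (p : CX).
have FF : Filter ((@Cinv_fun R G Y act \o extend_op) x @[x --> (p : Cinv_ptws R (sub_act Xinv))]).
  by apply: fmap_filter; exact: (@nbhs_filter (Cinv_ptws R (sub_act Xinv)) p).
have FF' : Filter (@Cinv_fun R G X (sub_act Xinv) @ nbhs (p : Cinv_ptws R (sub_act Xinv))).
  by apply: fmap_filter; exact: (@nbhs_filter (Cinv_ptws R (sub_act Xinv)) p).
apply/(pointwise_cvgP (extend_op p) FF) => z; apply/cvgrPdist_lt => e e0.
have e20 : 0 < e / 2 by rewrite divr_gt0.
have fV : finite_set (orbit_values z).
  by apply: bigcup_finite => // g _; rewrite finite_setU; split; exact: finite_values.
have ic : {ptws, @Cinv_fun R G X (sub_act Xinv) @
    nbhs (p : Cinv_ptws R (sub_act Xinv)) --> (p : CX)}.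
  exact: (@initial_continuous CX {ptws (X * X)%type -> R} (@Cinv_fun R G X (sub_act Xinv)) p).
have Hq : \forall q \near (p : Cinv_ptws R (sub_act Xinv)), forall t,
    (orbit_values z `*` orbit_values z) t -> `|(p : CX) t - (q : CX) t| <= e / 2.
  apply: (@near_finite _ (nbhs (p : Cinv_ptws R (sub_act Xinv))) _
    (orbit_values z `*` orbit_values z) (fun t q => `|(p : CX) t - (q : CX) t| <= e / 2)
    (@nbhs_filter (Cinv_ptws R (sub_act Xinv)) p)); first exact: finite_setX.
  by move=> t _; have /(pointwise_cvgP (p : CX) FF')/(_ t)/cvgrPdist_le/(_ _ e20) := ic.
apply: filterS Hq => q Hq; have [cq _] := CinvP (q : CX).
apply: (@le_lt_trans _ _ (e / 2)); last by rewrite ltr_pdivrMr // mulr_natr mulr2n ltrDl.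
by apply: extend_dist => // x x' vx vx'; apply: (Hq (x, x')).
Qed.

Lemma extend_op_bounded (p : CX) : bounded_fun p -> bounded_fun (extend_op p).
Proof.
have [cp _] := CinvP p; move=> [M [Mreal pM]]; exists M; split=> // N MN z _ /=.
rewrite ler_norml; apply: extend_bound => // x x' _ _; rewrite -ler_norml.
exact: (pM N MN (x, x') I).
Qed.

Lemma extend_op_pseudometric (p : CX) : is_pseudometric p -> is_pseudometric (extend_op p).
Proof.
have [cp _] := CinvP p => pp; apply: average_pseudometric => //; first exact: cpe.
exact: pair_ext_pseudometric.
Qed.

Lemma extend_op_metric (p : CX) : is_metric p -> is_metric (extend_op p).
Proof.
have [cp _] := CinvP p => pm; apply: average_metric => //; first exact: cpe.
exact: pair_ext_metric.
Qed.

Lemma extend_op_dominating (p : CX) : dominating d ->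
    (forall y n, tau n.+1 y < tau n.+2 y -> d (y, \val (node n y)) <= 3 * tau 1%N y) ->
  is_metric p -> dominating p -> dominating (extend_op p).
Proof.
have [cp _] := CinvP p => d_dom close pm p_dom; have [pp _] := pm.
apply: average_dominating => //; first exact: cpe.
  exact: pair_ext_pseudometric.
exact: pair_ext_dominating.
Qed.

End operator.

Theorem theorem3 (R : realType) (G : topologicalGroupType)
    (Y : topologicalType) (act : G -> Y -> Y) (X : set Y)
    (Gcompact : compact [set: G])
    (Ystrat : stratifiable Y)
    (act_cont : continuous_action act)
    (Xclosed : closed X)
    (Xinv : invariant_set act X)
    (Xge2 : exists x y, [/\ X x, X y & x <> y]) :
  exists T : {linear Cinv R (sub_act Xinv) -> Cinv R act},
    [/\ (forall p : Cinv R (sub_act Xinv),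
          (forall z, 0 <= p z) -> forall z, 0 <= T p z),
        (forall (p : Cinv R (sub_act Xinv)) (x y : X),
          T p (\val x, \val y) = p (x, y)),
        continuous (T : Cinv_compact_open R (sub_act Xinv) ->
                        Cinv_compact_open R act) &
        [/\ (forall c (p : Cinv R (sub_act Xinv)),
              (forall z, p z = c) -> forall z, T p z = c),
            (forall p : Cinv R (sub_act Xinv),
              bounded_fun p -> bounded_fun (T p)),
            (forall p : Cinv R (sub_act Xinv),
              is_pseudometric p -> is_pseudometric (T p)) &
            (forall p : Cinv R (sub_act Xinv),
              is_metric p -> is_metric (T p))]] /\
    (metrizable R Y ->
      forall p : Cinv R (sub_act Xinv),
        admissible_metric p -> admissible_metric (T p)) /\
    (finite_set [set: G] ->
      continuous (T : Cinv_ptws R (sub_act Xinv) -> Cinv_ptws R act)).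
Proof.
have [x [y [Xx Xy xy]]] := Xge2.
pose a : X := SigSub (mem_set Xx); pose b : X := SigSub (mem_set Xy).
have ab : a <> b by move=> /(congr1 val).
have [d [tau [node [dm dc d1 dg strong]]]] := @ex_extension_data R Y X a Ystrat Xclosed.
exists (extend_op Gcompact act_cont a b dm d1 dc dg); split; last split.
- split.
  + move=> p p0 z; have [cp _] := CinvP p; apply: extend_ge0 => //.
  + exact: extendE.
  + exact: extend_op_compact_open.
  + split.
    * move=> c p pc z; have [cp _] := CinvP p.
      apply/eqP; rewrite eq_le andbC; apply: extend_bound => // x' y' _ _.
      by rewrite pc lexx.
    * by move=> p; exact: extend_op_bounded.
    * by move=> p; exact: extend_op_pseudometric.
    * by move=> p; exact: extend_op_metric.
- move=> mY p [pm cp p_dom]; have [d_dom close] := strong mY.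
  split; first exact: extend_op_metric.
    by have [] := CinvP (extend_op Gcompact act_cont a b dm d1 dc dg p).
  exact: extend_op_dominating.
- exact: extend_op_ptws.
Qed.
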